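(* Let $\mu(s)$ be a rational function over $\mathbb{C}$ with a finite non-zero limit $\mu_0=\lim_{s\to\infty}\mu(s)$, and suppose that the identity $$ {}_2F_1\!\left(\tfrac12,\tfrac16;\tfrac76;\,z\right)=\left(\frac{\mu(1/z)}{\mu_0}\right)^{-1/2}{}_2F_1\!\left(\tfrac12,\tfrac16;\tfrac76;\,\frac{z}{\mu(1/z)^3}\right) $$ holds. Then there is a non-zero isogeny $\phi:E_2\to E_2$ of the elliptic curve $E_2:y^2=x^3-1$ that transforms the $x$-coordinate as $x\mapsto x\,\mu(x^3)$.
   Context: $E_2$ is the elliptic curve over $\mathbb{C}$ given by $y^2=x^3-1$, with the point at infinity as the neutral element. An isogeny here is an isogeny endomorphism: an algebraic map $E_2\to E_2$ respecting the addition law (equivalently, fixing the point at infinity). ''Transforms the $x$-coordinate as $x\mapsto x\,\mu(x^3)$'' means that the $x$-component of $\phi(x,y)$ is the function $x\,\mu(x^3)$. ${}_2F_1(A,B;C;z)$ is the Gauss hypergeometric function. The identity is one of analytic functions in a neighbourhood of $z=0$, where the power factor is the branch with value $1$ at $z=0$. *)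

(* Defs.v *)
From HB Require Import structures.
From mathcomp Require Import all_boot all_order all_algebra.
From mathcomp Require Import all_classical all_reals.
From mathcomp Require Import topology normedtype sequences.
From mathcomp Require Export complex.
From mathcomp Require Import ring.
(* The notations of mpoly clash with those of mathcomp-analysis. *)
From mathcomp Require Import -(notations) mpoly.

Set Implicit Arguments.
Unset Strict Implicit.
Unset Printing Implicit Defensive.

Import Order.TTheory GRing.Theory Num.Theory numFieldNormedType.Exports.
Local Open Scope classical_set_scope.
Local Open Scope ring_scope.
Local Open Scope quotient_scope.

Section Hypergeometric.
Variable K : numFieldType.
Implicit Types (a b c z : K).

Definition rising a (n : nat) : K := \prod_(k < n) (a + k%:R).

Definition hyp2F1_coef a b c (n : nat) : K :=
  rising a n * rising b n / (rising c n * n`!%:R).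

(* Meaningful for `|z| < 1 and c not in {0, -1, -2, ...}. *)
Definition hyp2F1 a b c z : K :=
  limn (series (fun n => hyp2F1_coef a b c n * z ^+ n)).

(* [0 < M] forces M to be real; this matters since the order of R[i] is
   partial and M < `|s| is false for non-real M. *)
Definition cvg_at_infinity (f : K -> K) (l : K) : Prop :=
  forall e : K, 0 < e ->
    exists2 M : K, 0 < M & forall s : K, M < `|s| -> `|f s - l| < e.

End Hypergeometric.

(* w ^ (- 1 / 2), principal branch: near w = 1 it is the branch with value 1
   at w = 1. The root sqrtC of numClosedFieldType would be wrong here: its
   imaginary part is always nonnegative, so it is discontinuous at w = 1. *)
Definition pow_mhalf (R : rcfType) (w : complex R) : complex R := (sqrtc w)^-1.

Lemma Re_sqrtc_ge0 (R : rcfType) (w : complex R) : 0 <= complex.Re (sqrtc w).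
Proof. by case: w => a b; rewrite /= sqrtr_ge0. Qed.

Lemma pow_mhalf1 (R : rcfType) : pow_mhalf (1 : complex R) = 1.
Proof. by rewrite /pow_mhalf sqrtc1 invr1. Qed.

Lemma pow_mhalf_sqr (R : rcfType) (w : complex R) : pow_mhalf w ^+ 2 = w^-1.
Proof. by rewrite /pow_mhalf exprVn sqr_sqrtc. Qed.

Lemma fraction_reprE (D : idomainType) (f : {fraction D}) :
  f = tofrac \n_(repr f) / tofrac \d_(repr f).
Proof.
have d0 := denom_ratioP (repr f).
have td0 : tofrac \d_(repr f) != 0 by rewrite tofrac_eq0.
apply: (mulIf td0); rewrite divfK // -{1}[f]reprK; unlock tofrac.
rewrite -[LHS]FracField.pi_mul; apply/eqmodP => /=.
rewrite FracField.equivfE /FracField.mulf.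
by rewrite !numden_Ratio ?mulf_neq0 ?oner_neq0 // !mulr1 mulrC.
Qed.

Section RationalFunctions.
Variable K : fieldType.
Implicit Types (f : {fraction {poly K}}) (s : K).

Definition rf_gcd f : {poly K} := gcdp \n_(repr f) \d_(repr f).
Definition rf_num f : {poly K} := \n_(repr f) %/ rf_gcd f.
Definition rf_den f : {poly K} := \d_(repr f) %/ rf_gcd f.

(* The value is junk at the poles, that is, at the roots of rf_den f. *)
Definition rf_eval f s : K := (rf_num f).[s] / (rf_den f).[s].
Definition rf_pole f s : bool := root (rf_den f) s.

Lemma rf_den_neq0 f : rf_den f != 0.
Proof.
have d0 := denom_ratioP (repr f).
by rewrite dvdp_div_eq0 ?dvdp_gcdr.
Qed.

Lemma coprime_rf f : coprimep (rf_num f) (rf_den f).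
Proof.
apply: coprimep_div_gcd; apply/orP; right; exact: denom_ratioP.
Qed.

Lemma rf_numdenE f : f = tofrac (rf_num f) / tofrac (rf_den f).
Proof.
have d0 := denom_ratioP (repr f).
have En : rf_num f * rf_gcd f = \n_(repr f) by rewrite divpK ?dvdp_gcdl.
have Ed : rf_den f * rf_gcd f = \d_(repr f) by rewrite divpK ?dvdp_gcdr.
have g0 : rf_gcd f != 0 by rewrite gcdp_eq0 negb_and d0 orbT.
rewrite [LHS]fraction_reprE -En -Ed !tofracM invfM mulrACA divff ?mulr1 //.
by rewrite tofrac_eq0.
Qed.

End RationalFunctions.

Section EllipticCurve.
Variable K : fieldType.

(* None is the point at infinity. *)
Definition onE2 (P : option (K * K)) : bool :=
  if P is Some (x, y) then y ^+ 2 == x ^+ 3 - 1 else true.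

Definition E2 : Type := {P : option (K * K) | onE2 P}.

Definition E2_zero : E2 := exist (fun P => onE2 P) None isT.

(* The third intersection point of the line through (x1, y1) with slope l,
   where x2 is the abscissa of the second one, reflected in the x-axis. *)
Definition chord_point (l x1 y1 x2 : K) : option (K * K) :=
  let x3 := l ^+ 2 - x1 - x2 in Some (x3, l * (x1 - x3) - y1).

Definition E2_add_raw (P Q : option (K * K)) : option (K * K) :=
  match P, Q with
  | None, _ => Q
  | _, None => P
  | Some (x1, y1), Some (x2, y2) =>
      if x1 != x2 then chord_point ((y2 - y1) / (x2 - x1)) x1 y1 x2
      else if y1 == - y2 then None
      else chord_point (3 * x1 ^+ 2 / (2 * y1)) x1 y1 x2
  end.

Lemma onE2_add P Q : onE2 P -> onE2 Q -> onE2 (E2_add_raw P Q).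
Proof.
case: P Q => [[x1 y1]|] [[x2 y2]|] //= /eqP e1 /eqP e2.
case: eqVneq => [ex|nx] /=; last first.
  have d0 : x2 - x1 != 0 by rewrite subr_eq0 eq_sym.
  set l := (y2 - y1) / _.
  have el : l * (x2 - x1) = y2 - y1 by rewrite divfK.
  have ey2 : y2 = y1 + l * (x2 - x1) by rewrite el; ring.
  have e3 : x2 ^+ 3 - 1 = (y1 + l * (x2 - x1)) ^+ 2 by rewrite -ey2.
  have e4 : x2 ^+ 3 - 1 - (x1 ^+ 3 - 1) - ((y1 + l * (x2 - x1)) ^+ 2 - y1 ^+ 2) = 0.
    by rewrite e3 -e1; ring.
  have e5 : x2 ^+ 2 + x1 * x2 + x1 ^+ 2 - l * (2 * y1 + l * (x2 - x1)) = 0.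
    by apply: (mulfI d0); rewrite mulr0 -e4; ring.
  rewrite -subr_eq0; apply/eqP.
  transitivity ((y1 ^+ 2 - (x1 ^+ 3 - 1)) - (l ^+ 2 - x1 - x2 - x1)
      * (x2 ^+ 2 + x1 * x2 + x1 ^+ 2 - l * (2 * y1 + l * (x2 - x1)))).
    ring.
  by rewrite e5 e1 subrr mulr0 subr0.
rewrite -{x2}ex in e2 *.
case: eqVneq => [//|ny] /=.
have y0 : 2 * y1 != 0.
  have : (y1 - y2) * (y1 + y2) == 0.
    by rewrite -subr_sqr e1 e2 subrr.
  rewrite mulf_eq0 subr_eq0 addr_eq0 (negbTE ny) orbF => /eqP ey.
  by rewrite mulr_natl mulr2n {2}ey addr_eq0.
set l := _ / _.
have el : l * (2 * y1) = 3 * x1 ^+ 2 by rewrite divfK.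
rewrite -subr_eq0; apply/eqP.
transitivity ((y1 ^+ 2 - (x1 ^+ 3 - 1)) - (l ^+ 2 - x1 - x1 - x1)
    * (3 * x1 ^+ 2 - l * (2 * y1))).
  ring.
by rewrite el e1 !subrr mulr0 subr0.
Qed.

Definition E2_add (P Q : E2) : E2 :=
  exist (fun P => onE2 P) (E2_add_raw (val P) (val Q))
    (onE2_add (valP P) (valP Q)).

(* Homogeneous coordinates in the projective plane: (x, y) is [x : y : 1] and
   the point at infinity is [0 : 1 : 0]. *)
Definition E2_proj (P : E2) (i : 'I_3) : K :=
  if val P is Some (x, y) then nth 0 [:: x; y; 1] i else nth 0 [:: 0; 1; 0] i.

(* Around every point, phi is given by a triple of homogeneous polynomials of
   the same degree without common zero at that point. *)
Definition E2_algebraic_map (phi : E2 -> E2) : Prop :=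
  forall P : E2, exists (d : nat) (F : 'I_3 -> mpoly 3 K),
    [/\ forall i, F i \is ishomog1 d mdeg,
        exists i, meval (E2_proj P) (F i) != 0
      & forall Q : E2, (exists i, meval (E2_proj Q) (F i) != 0) ->
          exists2 c : K, c != 0 &
            forall i, meval (E2_proj Q) (F i) = c * E2_proj (phi Q) i].

Definition E2_isogeny (phi : E2 -> E2) : Prop :=
  E2_algebraic_map phi /\
  (forall P Q, phi (E2_add P Q) = E2_add (phi P) (phi Q)).

(* The x-coordinate of phi (x, y), as a map to the projective line, is
   x * mu (x ^ 3).  This rational function of x has a pole exactly where mu has
   one at x ^ 3: if 0 is a pole of mu, then x does not cancel the pole of
   mu (x ^ 3) at 0, whose order is at least 3. *)
Definition E2_transforms_x (mu : {fraction {poly K}}) (phi : E2 -> E2) : Prop :=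
  forall (P : E2) (x y : K), val P = Some (x, y) ->
    if rf_pole mu (x ^+ 3) then phi P = E2_zero
    else exists y' : K, val (phi P) = Some (x * rf_eval mu (x ^+ 3), y').

End EllipticCurve.

(* Main.v *)
Require Import Defs.
From HB Require Import structures.
From mathcomp Require Import all_boot all_order all_algebra.
From mathcomp Require Import all_classical all_reals.
From mathcomp Require Import topology normedtype sequences.
From mathcomp Require Import -(notations) mpoly.
From mathcomp Require Import ring.
Import Order.TTheory GRing.Theory Num.Theory numFieldNormedType.Exports.

(** With [z = x^-3], the function [x^(-1/2) F(x^-3)], where [F] is the
    hypergeometric function of the statement, is half the integral of
    [dt / sqrt(t^3 - 1)] from [x] to infinity. The identity therefore says that
    [X = x mu(x^3)] satisfies [c dX / sqrt(X^3 - 1) = dx / sqrt(x^3 - 1)] with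
    [c^2 = mu0], that is, [c^2 X'^2 (x^3 - 1) = X^3 - 1]. So
    [phi : (x, y) -> (X, c y X')] maps the curve to itself and multiplies the
    invariant differential [dx / y] by a constant. Such a map that fixes the
    point at infinity is a homomorphism.

    The differential equation is derived with truncated power series, so that
    differentiation stays formal. Truncating [F] at order [n] changes the
    identity by [O(z^(n+1))], which makes it a congruence between polynomials
    modulo [X^(n+1)] ([hyp2F1_truncated_identity]). Its derivative, combined
    with [6 X F' + F = (1 - X)^(-1/2)], yields the equation modulo [X^n] for
    all [n] ([formal_ode]), hence exactly; [rev_ode] brings it from
    [z = 1 / s] back to the variable [s = x^3]. In terms of [mu = N / D] and
    [B = N D + 3 s (N' D - N D')] it reads
    [c^2 B^2 (s - 1) = D (s N^3 - D^3)].

    Poles of [phi] are handled by the same equation, which forces their orders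
    ([pole_orders]) and so shows which factors to cancel in the homogeneous
    triple [x N D : c y B : D^2] in order to extend it to all points
    ([phi_algebraic]).

    For additivity, rational functions on the curve are differentiated along
    the invariant vector field. If two maps to the curve multiply the invariant
    differential by [l] and [m], their sum multiplies it by [l + m]
    ([regmapD]). Hence [P -> phi P + phi (Q - P)] multiplies it by zero and is
    constant ([regular_constant]). The constant is [phi Q]: the curve has an
    automorphism [e] with [e + e^-1 = 1], the map [phi] commutes with it, and at
    [P = e Q] the sum is [e (phi Q) + e^-1 (phi Q)] ([phi_split_affine]). This
    holds for all [P] outside a finite set that depends on [Q]; additivity
    everywhere follows by shifting by a generic point ([phiD]). That argument,
    and the associativity of the group law itself ([E2_addA]), rest on there
    being infinitely many points. *)

Set Implicit Arguments.
Unset Strict Implicit.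
Unset Printing Implicit Defensive.
Local Open Scope ring_scope.

(** * The group law of the curve *)

Section RawGroup.
Variable K : numFieldType.
Implicit Types (x y l : K) (P Q R : option (K * K)).

Definition E2_opp_raw P : option (K * K) :=
  if P is Some (x, y) then Some (x, - y) else None.

Lemma onE2_opp P : onE2 P -> onE2 (E2_opp_raw P).
Proof. by case: P => [[x y]|] //=; rewrite sqrrN. Qed.

Lemma E2_same_x x y1 y2 : y1 ^+ 2 = x ^+ 3 - 1 -> y2 ^+ 2 = x ^+ 3 - 1 ->
  y1 = y2 \/ y1 = - y2.
Proof.
move=> e1 e2; have /eqP : y1 ^+ 2 = y2 ^+ 2 by rewrite e1.
by rewrite eqf_sqr => /orP[] /eqP; [left | right].
Qed.

Lemma E2_add_rawC P Q : onE2 P -> onE2 Q -> E2_add_raw P Q = E2_add_raw Q P.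
Proof.
case: P Q => [[x1 y1]|] [[x2 y2]|] //= /eqP e1 /eqP e2.
rewrite [x2 == x1]eq_sym; case: eqVneq => [ex|nx] /=; last first.
  have d : x2 - x1 != 0 by rewrite subr_eq0 eq_sym.
  have d' : x1 - x2 != 0 by rewrite subr_eq0.
  by congr (Some (_, _)); field; rewrite ?d ?d'.
subst x2; rewrite -[y2 == _]eqr_oppLR [- y2 == _]eq_sym; case: eqVneq => //= ny.
by case: (E2_same_x e1 e2) => [->//|e]; rewrite e eqxx in ny.
Qed.

(** The delicate case is the one where the sum is the opposite of [Q]:
    the line through [P] and [Q] is then the tangent at [Q]. *)
Lemma E2_add_rawK P Q : onE2 P -> onE2 Q ->
  E2_add_raw (E2_add_raw P Q) (E2_opp_raw Q) = P.
Proof.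
have n2 : (2 : K) != 0 by rewrite pnatr_eq0.
case: P Q => [[x1 y1]|] [[x2 y2]|] //= /eqP e1 /eqP e2;
  last by rewrite eqxx /= opprK eqxx.
case: eqVneq => [ex|nx] /=.
  subst x2; case: (eqVneq y1 (- y2)) => [-> //|ny] /=.
  have ey : y1 = y2 by case: (E2_same_x e1 e2) => // e; rewrite e eqxx in ny.
  subst y2; clear e2.
  have y0 : y1 != 0 by apply: contraNneq ny => ->; rewrite oppr0.
  set l := _ / _.
  have el : 3 * x1 ^+ 2 = l * (2 * y1) by rewrite divfK // mulf_neq0.
  case: eqVneq => [ex|nx] /=; last first.
    have d : x1 - (l ^+ 2 - x1 - x1) != 0 by rewrite subr_eq0 eq_sym.
    have -> : (- y1 - (l * (x1 - (l ^+ 2 - x1 - x1)) - y1)) /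
        (x1 - (l ^+ 2 - x1 - x1)) = - l by field.
    rewrite /chord_point sqrrN; congr (Some (_, _)); ring.
  rewrite ex subrr mulr0 sub0r opprK; case: eqVneq => [e|_] /=.
    by move: y0; rewrite -(mulrI_eq0 _ (mulfI n2)) mulr_natl mulr2n -{1}e addNr eqxx.
  rewrite mulrN invrN mulrN -/l /chord_point sqrrN ex subrr mulr0 sub0r opprK.
  by [].
set l := _ / _.
have d : x2 - x1 != 0 by rewrite subr_eq0 eq_sym.
have ey2 : y2 = y1 + l * (x2 - x1) by rewrite /l divfK //; ring.
case: eqVneq => [ex|nx'] /=.
  have e3 : x2 ^+ 2 + x1 * x2 + x1 ^+ 2 = l * (y1 + y2).
    by rewrite /l; field: e1 e2; rewrite d.
  have el : l ^+ 2 = x1 + 2 * x2.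
    by move: ex => /(canRL (subrK _)) /(canRL (subrK _)) ->; ring.
  have e4 : 3 * x2 ^+ 2 = l * (2 * y2).
    have -> : 3 * x2 ^+ 2 = x2 ^+ 2 + x1 * x2 + x1 ^+ 2 + (x1 + 2 * x2) * (x2 - x1) by ring.
    by rewrite e3 -el ey2; ring.
  have y0 : y2 != 0.
    apply/eqP => y0; move: e4 e2; rewrite y0 !mulr0 => /eqP.
    rewrite mulf_eq0 pnatr_eq0 /= expf_eq0 /= => /eqP ->.
    by rewrite !expr0n /= sub0r => /eqP; rewrite eq_sym oppr_eq0 oner_eq0.
  have -> : l * (x1 - (l ^+ 2 - x1 - x2)) - y1 = - y2 by rewrite ex ey2; ring.
  rewrite opprK; case: eqVneq => [e|_] /=.
    by move: y0; rewrite -(mulrI_eq0 _ (mulfI n2)) mulr_natl mulr2n -{1}e addNr eqxx.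
  rewrite ex mulrN invrN mulrN e4 mulfK ?mulf_neq0 // /chord_point sqrrN el ey2.
  by congr (Some (_, _)); ring.
have d' : x2 - (l ^+ 2 - x1 - x2) != 0 by rewrite subr_eq0 eq_sym.
have -> : (- y2 - (l * (x1 - (l ^+ 2 - x1 - x2)) - y1)) / (x2 - (l ^+ 2 - x1 - x2)) = - l.
  by rewrite ey2; field.
rewrite /chord_point sqrrN; congr (Some (_, _)); ring.
Qed.

Lemma chord_assoc x1 y1 x2 y2 x3 y3 :
  y1 ^+ 2 = x1 ^+ 3 - 1 -> y2 ^+ 2 = x2 ^+ 3 - 1 -> y3 ^+ 2 = x3 ^+ 3 - 1 ->
  x2 - x1 != 0 -> x3 - x2 != 0 ->
  let l12 := (y2 - y1) / (x2 - x1) in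
  let x12 := l12 ^+ 2 - x1 - x2 in let y12 := l12 * (x1 - x12) - y1 in
  let l23 := (y3 - y2) / (x3 - x2) in
  let x23 := l23 ^+ 2 - x2 - x3 in let y23 := l23 * (x2 - x23) - y2 in
  x3 - x12 != 0 -> x23 - x1 != 0 ->
  chord_point ((y3 - y12) / (x3 - x12)) x12 y12 x3 =
  chord_point ((y23 - y1) / (x23 - x1)) x1 y1 x23.
Proof.
move=> e1 e2 e3 n1 n2 l12 x12 y12 l23 x23 y23 n3 n4.
rewrite /y23 /y12 /x23 /x12 /l23 /l12 in n3 n4 *.
have n3' : x3 * (x2 - x1) ^+ 2 -
      ((y2 - y1) ^+ 2 + - x1 * (x2 - x1) ^+ 2 + - x2 * (x2 - x1) ^+ 2) != 0.
  apply: contraNneq n3 => e; apply/eqP.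
  by apply: (mulfI (expf_neq0 2 n1)); rewrite mulr0 -[RHS]e; field.
have n4' : (y3 - y2) ^+ 2 + - x2 * (x3 - x2) ^+ 2 + - x3 * (x3 - x2) ^+ 2 +
      - x1 * (x3 - x2) ^+ 2 != 0.
  apply: contraNneq n4 => e; apply/eqP.
  by apply: (mulfI (expf_neq0 2 n2)); rewrite mulr0 -[RHS]e; field.
rewrite /chord_point; congr (Some (_, _)); apply: subr0_eq;
  by field: e1 e2 e3; rewrite n1 n2 n3' n4'.
Qed.

Lemma tangent_assoc x1 y1 x3 y3 :
  y1 ^+ 2 = x1 ^+ 3 - 1 -> y3 ^+ 2 = x3 ^+ 3 - 1 ->
  y1 != 0 -> x3 - x1 != 0 ->
  let l12 := 3 * x1 ^+ 2 / (2 * y1) in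
  let x12 := l12 ^+ 2 - x1 - x1 in let y12 := l12 * (x1 - x12) - y1 in
  let l23 := (y3 - y1) / (x3 - x1) in
  let x23 := l23 ^+ 2 - x1 - x3 in let y23 := l23 * (x1 - x23) - y1 in
  x3 - x12 != 0 -> x23 - x1 != 0 ->
  chord_point ((y3 - y12) / (x3 - x12)) x12 y12 x3 =
  chord_point ((y23 - y1) / (x23 - x1)) x1 y1 x23.
Proof.
move=> e1 e3 n1 n2 l12 x12 y12 l23 x23 y23 n3 n4.
have n0 : (2 : K) != 0 by rewrite pnatr_eq0.
rewrite /y23 /y12 /x23 /x12 /l23 /l12 in n3 n4 *.
have n3' : x3 * (4 * y1 ^+ 2) -
      ((3 * x1 ^+ 2) ^+ 2 + - x1 * (4 * y1 ^+ 2) + - x1 * (4 * y1 ^+ 2)) != 0.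
  apply: contraNneq n3 => e; apply/eqP.
  by apply: (mulfI (expf_neq0 2 (mulf_neq0 n0 n1))); rewrite mulr0 -[RHS]e; field.
have n4' : (y3 - y1) ^+ 2 + - x1 * (x3 - x1) ^+ 2 + - x3 * (x3 - x1) ^+ 2 +
      - x1 * (x3 - x1) ^+ 2 != 0.
  apply: contraNneq n4 => e; apply/eqP.
  by apply: (mulfI (expf_neq0 2 n2)); rewrite mulr0 -[RHS]e; field.
rewrite /chord_point; congr (Some (_, _)); apply: subr0_eq;
  by field: e1 e3; rewrite n1 n2 n3' n4'.
Qed.

End RawGroup.

Section Group.
Variable K : numClosedFieldType.
Implicit Types (P Q R W : E2 K).

HB.instance Definition _ := [Choice of E2 K by <:].

Definition E2_opp P : E2 K :=
  exist (fun p => onE2 p) (E2_opp_raw (val P)) (onE2_opp (valP P)).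

Lemma val_E2_add P Q : val (E2_add P Q) = E2_add_raw (val P) (val Q).
Proof. by []. Qed.

Lemma E2_addC : commutative (@E2_add K).
Proof. by move=> P Q; apply/val_inj/E2_add_rawC; apply: valP. Qed.

Lemma E2_add0 : left_id (E2_zero K) (@E2_add K).
Proof. by move=> P; apply/val_inj => /=; case: (val P) => [[]|]. Qed.

Lemma E2_addN : left_inverse (E2_zero K) E2_opp (@E2_add K).
Proof.
move=> P; apply/val_inj => /=; case: (val P) => [[x y]|] //=.
by rewrite eqxx /= eqxx.
Qed.

Lemma E2_addK P Q : E2_add (E2_add P Q) (E2_opp Q) = P.
Proof. by apply/val_inj/E2_add_rawK; apply: valP. Qed.

Lemma E2_infinite (s : seq (E2 K)) : exists P, P \notin s.
Proof.
pose xs := [seq if val P is Some (x, _) then x else 0 | P <- s].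
have [n nxs] : exists n : nat, n%:R \notin xs.
  pose ns : seq K := [seq n%:R | n <- iota 0 (size xs).+1].
  have ins : injective (fun n : nat => n%:R : K).
    by move=> m n /eqP; rewrite eqr_nat => /eqP.
  have uns : uniq ns by rewrite map_inj_uniq // iota_uniq.
  case: (boolP (all (mem xs) ns)) => [/allP sub|].
    have := uniq_leq_size uns (fun x h => sub x h).
    by rewrite size_map size_iota ltnn.
  by rewrite -has_predC => /hasP[x /mapP[n _ ->] /= h]; exists n.
have on : onE2 (Some (n%:R, sqrtC (n%:R ^+ 3 - 1)) : option (K * K)).
  by rewrite /= sqrtCK.
exists (exist (fun p => onE2 p) _ on); apply: contra nxs => h.
by apply/mapP; exists (exist (fun p => onE2 p) _ on).
Qed.

Lemma E2_same_abscissa P Q x y1 y2 : val P = Some (x, y1) ->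
  val Q = Some (x, y2) -> P = Q \/ P = E2_opp Q.
Proof.
move=> eP eQ; move: (valP P) (valP Q); rewrite eP eQ /= => /eqP e1 /eqP e2.
by case: (E2_same_x e1 e2) => e; [left | right]; apply/val_inj;
  rewrite /= eP eQ /= e.
Qed.

(** Away from finitely many [W] the three sums with [W] are taken along chords,
    so that associativity is a rational identity: [chord_assoc], or
    [tangent_assoc] if [P = Q]. *)
Lemma E2_addA_generic P Q : exists s : seq (E2 K), forall W, W \notin s ->
  E2_add (E2_add P Q) W = E2_add P (E2_add Q W).
Proof.
case: (eqVneq P (E2_zero K)) => [->|nP]; first by exists [::] => W _; rewrite !E2_add0.
case: (eqVneq Q (E2_zero K)) => [->|nQ].
  by exists [::] => W _; rewrite E2_add0 [E2_add P _]E2_addC E2_add0.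
case: (eqVneq P (E2_opp Q)) => [->|nPQ].
  exists [::] => W _.
  by rewrite E2_addN E2_add0 E2_addC [E2_add Q W]E2_addC E2_addK.
exists [:: E2_zero K; Q; E2_opp Q; E2_add P Q; E2_opp (E2_add P Q);
          E2_add P (E2_opp Q); E2_add (E2_opp P) (E2_opp Q)] => W.
rewrite !inE !negb_or => /and5P[nW n1 n2 n3 /and3P[n4 n5 n6]].
have n7 : E2_add Q W != P.
  by apply: contraNneq n5 => <-; rewrite [E2_add Q W]E2_addC E2_addK.
have n8 : E2_add Q W != E2_opp P.
  by apply: contraNneq n6 => <-; rewrite [E2_add Q W]E2_addC E2_addK.
case eP: (val P) nP => [[x1 y1]|]; last by rewrite -(inj_eq val_inj) eP.
case eQ: (val Q) nQ => [[x2 y2]|]; last by rewrite -(inj_eq val_inj) eQ.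
case eW: (val W) nW => [[x3 y3]|]; last by rewrite -(inj_eq val_inj) eW.
move=> _ _ _.
have ne A B x y x' y' : val A = Some (x, y) -> val B = Some (x', y') ->
    A != B -> A != E2_opp B -> x - x' != 0.
  move=> eA eB h h'; rewrite subr_eq0; apply/eqP => exx.
  by case: (@E2_same_abscissa A B x y y'); rewrite -?exx // in eB *;
    move=> eAB; rewrite eAB eqxx in h h'.
have d23 : x3 - x2 != 0 by apply: (ne W Q _ y3 _ y2).
have eQW : val (E2_add Q W) = E2_add_raw (Some (x2, y2)) (Some (x3, y3)).
  by rewrite val_E2_add eQ eW.
have ePQ : val (E2_add P Q) = E2_add_raw (Some (x1, y1)) (Some (x2, y2)).
  by rewrite val_E2_add eP eQ.
move: (valP P) (valP Q) (valP W); rewrite eP eQ eW => /eqP c1 /eqP c2 /eqP c3.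
have nx23 : x2 != x3 by rewrite eq_sym -subr_eq0.
have d5 := ne _ _ _ _ _ _ _ eP n7 n8.
rewrite /E2_add_raw nx23 /chord_point in eQW.
have {}d5 := d5 _ _ eQW.
apply/val_inj; rewrite [LHS]val_E2_add ePQ eW [RHS]val_E2_add eQW eP.
have nx4 := d5; rewrite subr_eq0 eq_sym in nx4.
rewrite [RHS]/E2_add_raw nx4.
rewrite /E2_add_raw in ePQ *.
have d6 := ne _ _ _ _ _ _ eW _ n3 n4.
case: (eqVneq x1 x2) ePQ => [ex|nx] /= ePQ; last first.
  have {}d6 := d6 _ _ ePQ.
  have nx5 := d6; rewrite subr_eq0 eq_sym in nx5.
  rewrite nx5; apply: chord_assoc => //; by rewrite subr_eq0 eq_sym.
have ny : y1 != - y2.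
  apply: contraNneq nPQ => ey; apply/eqP/val_inj => /=; rewrite eP eQ /=.
  by rewrite ex ey.
have ey : y1 = y2.
  move: c2; rewrite -ex => c2.
  by case: (E2_same_x c1 c2) => // e; rewrite e eqxx in ny.
subst x2 y2; rewrite (negbTE ny) /= in ePQ *.
have {}d6 := d6 _ _ ePQ.
have nx5 := d6; rewrite subr_eq0 eq_sym in nx5.
rewrite nx5; apply: tangent_assoc => //.
by apply: contraNneq ny => ->; rewrite oppr0.
Qed.

(** A generic summand [W] added on the right may be moved across all brackets,
    and cancelled at the end by [E2_addK]. *)
Lemma E2_addA : associative (@E2_add K).
Proof.
move=> P Q R.
have [s1 h1] := E2_addA_generic (E2_add P Q) R.
have [s2 h2] := E2_addA_generic P Q.
have [s3 h3] := E2_addA_generic Q R.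
have [s4 h4] := E2_addA_generic P (E2_add Q R).
have [W] := E2_infinite (s1 ++ [seq E2_add T (E2_opp R) | T <- s2] ++ s3 ++ s4).
rewrite !mem_cat !negb_or => /and4P[n1 n2 n3 n4].
have n2' : E2_add R W \notin s2.
  apply: contra n2 => h; apply/mapP; exists (E2_add R W) => //.
  by rewrite E2_addC [E2_add R W]E2_addC E2_addC E2_addK.
rewrite -[LHS](E2_addK _ W) -[RHS](E2_addK _ W).
by rewrite h1 // h2 // h4 // h3.
Qed.

HB.instance Definition _ :=
  GRing.isZmodule.Build (E2 K) E2_addA E2_addC E2_add0 E2_addN.

Lemma E2_addE P Q : E2_add P Q = P + Q. Proof. by []. Qed.
Lemma E2_oppE P : E2_opp P = - P. Proof. by []. Qed.
End Group.

(** * Polynomials with few zeros *)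

Section Polynomials.
Variable K : numClosedFieldType.
Implicit Types (p q : {poly K}) (s : seq K).

Lemma poly_neq0_point p : p != 0 -> exists x, p.[x] != 0.
Proof.
move=> p0; pose ns : seq K := [seq n%:R | n <- iota 0 (size p)].
have uns : uniq ns.
  rewrite map_inj_uniq ?iota_uniq // => m n /eqP.
  by rewrite eqr_nat => /eqP.
case: (boolP (all (root p) ns)) => [h|].
  by have := max_poly_roots p0 h uns; rewrite size_map size_iota ltnn.
by rewrite -has_predC => /hasP[x _ /= h]; exists x.
Qed.

Lemma poly0_cofinite p s : (forall x, x \notin s -> p.[x] = 0) -> p = 0.
Proof.
move=> h; apply/eqP; apply: contraT => p0.
have q0 : \prod_(x <- s) ('X - x%:P) != 0.
  by rewrite monic_neq0 // monic_prod_XsubC.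
have [x] := poly_neq0_point (mulf_neq0 p0 q0).
rewrite hornerM mulf_eq0 negb_or => /andP[px].
by rewrite -[_ != 0]/(~~ root _ x) root_prod_XsubC => /h /eqP; rewrite (negbTE px).
Qed.

Lemma poly_root_seq p : p != 0 -> exists s, forall x, x \notin s -> p.[x] != 0.
Proof.
move=> p0; have [s e] := closed_field_poly_normal p.
exists s => x xs; rewrite e hornerZ mulf_neq0 ?lead_coef_eq0 //.
by rewrite -[_ != 0]/(~~ root _ x) root_prod_XsubC.
Qed.

(** Subtract from [p] the multiple of [q] with the same value at a point where
    [q] does not vanish: the difference solves the same equation, which rules
    out a zero of finite order at that point. *)
Lemma wronskian0 p q : q != 0 -> p^`() * q = p * q^`() ->
  exists a, p = a *: q.
Proof.
move=> q0 w; have [x qx] := poly_neq0_point q0.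
exists (p.[x] / q.[x]); apply/eqP; rewrite -subr_eq0.
set r := p - _; apply: contraT => r0.
have wr : r^`() * q = r * q^`().
  by rewrite /r derivB derivZ !mulrBl w -!scalerAl [q^`() * q]mulrC.
have rx : root r x by rewrite /root /r !hornerE divfK // subrr.
have [[|n] [m hm e]] := multiplicity_XsubC r x.
  by move: rx hm; rewrite r0 e expr0 mulr1 => -> .
rewrite r0 /= in hm.
pose l := 'X - x%:P.
have : l ^+ n * (n.+1%:R * m * q + l * (m^`() * q - m * q^`())) = 0.
  transitivity (r^`() * q - r * q^`()); last by rewrite wr subrr.
  rewrite e derivM deriv_exp derivXsubC mul1r -/l /= exprS mulr_natl.
  rewrite -[in RHS]mulr_natl; ring.
move/eqP; rewrite mulf_eq0 expf_eq0 polyXsubC_eq0 andbF /=.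
move=> /eqP/(congr1 (horner^~ x)); rewrite !hornerE subrr mul0r addr0 => /eqP.
rewrite !mulf_eq0 (negbTE qx) orbF -[m.[x] == 0]/(root m x) (negbTE hm) orbF.
by rewrite hornerMn hornerC pnatr_eq0.
Qed.

(** Otherwise the two sides would have degrees of different parity. *)
Lemma sqr_cubic0 p q a : a *: p ^+ 2 = q ^+ 2 * ('X^3 - 1) -> q = 0.
Proof.
move=> e; apply/eqP; apply: contraT => q0; move: e.
have s3 : size ('X^3 - 1 : {poly K}) = 4 by rewrite size_XnsubC.
have c0 : ('X^3 - 1 : {poly K}) != 0 by rewrite -size_poly_eq0 s3.
case: (eqVneq (a *: p ^+ 2) 0) => [-> /esym/eqP|].
  by rewrite mulf_eq0 expf_eq0 (negbTE q0) (negbTE c0).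
rewrite scaler_eq0 expf_eq0 /= negb_or => /andP[a0 p0].
move/(congr1 (size : {poly K} -> nat)); rewrite size_scale // !expr2.
rewrite !size_mul ?mulf_neq0 // s3.
case: (size p) (size_poly_eq0 p) p0 => [/esym/eqP-> /eqP//|m _ _].
case: (size q) (size_poly_eq0 q) q0 => [/esym/eqP-> /eqP//|n _ _].
move/(congr1 odd); rewrite !addSn !addnS /= !addn0 !oddD.
by case: (odd m); case: (odd n).
Qed.
End Polynomials.

(** * Functions on the curve and their invariant derivative *)

(** Polynomial identities are proved after evaluation at a point, where the
   equation of the curve is available. Powers come before products, which would
   otherwise match them. *)
Ltac push_eval := rewrite ?(derivD, derivN, derivM, derivXn, derivX, derivC, linear0)
  ?(hornerXn, horner_exp, hornerD, hornerN, hornerM, hornerZ, hornerC, hornerX,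
    hornerMn, horner0).

Section Functions.
Variable K : numClosedFieldType.
Implicit Types (P Q : E2 K) (f g u v d : E2 K -> K) (S : E2 K -> Prop).

Definition xc P : K := if val P is Some (x, _) then x else 0.
Definition yc P : K := if val P is Some (_, y) then y else 0.

Lemma val_affine P : P != 0 -> val P = Some (xc P, yc P).
Proof.
by rewrite /xc /yc -(inj_eq val_inj); case: (val P) => [[x y]|].
Qed.

Lemma curveE P : P != 0 -> yc P ^+ 2 = xc P ^+ 3 - 1.
Proof. by move=> /val_affine e; have := valP P; rewrite e => /eqP. Qed.

Lemma xyc_inj P Q : P != 0 -> Q != 0 -> xc P = xc Q -> yc P = yc Q -> P = Q.
Proof.
move=> /val_affine eP /val_affine eQ ex ey.
by apply: val_inj; rewrite eP eQ ex ey.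
Qed.

Definition affine_point (x y : K) (h : y ^+ 2 = x ^+ 3 - 1) : E2 K :=
  exist (fun p => onE2 p) (Some (x, y)) (introT eqP h).

Lemma affine_point_neq0 x y (h : y ^+ 2 = x ^+ 3 - 1) : affine_point h != 0.
Proof. by rewrite -(inj_eq val_inj). Qed.

Lemma xyc_some P x y : val P = Some (x, y) -> [/\ P != 0, xc P = x & yc P = y].
Proof. by rewrite -(inj_eq val_inj) /xc /yc => ->. Qed.

Lemma E2_point_over (x : K) : exists2 P, P != 0 & xc P = x.
Proof.
have h : sqrtC (x ^+ 3 - 1) ^+ 2 = x ^+ 3 - 1 by rewrite sqrtCK.
by exists (affine_point h) => //; apply: affine_point_neq0.
Qed.

Lemma xcN P : xc (- P) = xc P.
Proof. by rewrite /xc -E2_oppE /=; case: (val P) => [[]|]. Qed.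
Lemma ycN P : yc (- P) = - yc P.
Proof. by rewrite /yc -E2_oppE /=; case: (val P) => [[]|]; rewrite ?oppr0. Qed.

(** [f] is a function in the coordinate ring [K[x] + K[x] y], and [g] is its
    derivative along the invariant vector field, for which [x' = 2 y] and
    [y' = 3 x^2]. *)
Definition polyfun f g := exists A B : {poly K}, forall P, P != 0 ->
  f P = A.[xc P] + B.[xc P] * yc P /\
  g P = 2 * A^`().[xc P] * yc P +
        (2 * (xc P ^+ 3 - 1) * B^`().[xc P] + 3 * xc P ^+ 2 * B.[xc P]).

Lemma polyfunC (c : K) : polyfun (fun=> c) (fun=> 0).
Proof.
exists c%:P, 0 => P _; split; push_eval; ring.
Qed.

Lemma polyfun_x : polyfun xc (fun P => 2 * yc P).
Proof. exists 'X, 0 => P _; split; push_eval; ring. Qed.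

Lemma polyfun_y : polyfun yc (fun P => 3 * xc P ^+ 2).
Proof. exists 0, 1 => P _; split; push_eval; ring. Qed.

Lemma polyfunD f f' g g' : polyfun f f' -> polyfun g g' ->
  polyfun (fun P => f P + g P) (fun P => f' P + g' P).
Proof.
move=> [A [B h]] [A1 [B1 h1]]; exists (A + A1), (B + B1) => P P0.
have [-> ->] := h P P0; have [-> ->] := h1 P P0.
by push_eval; split; ring.
Qed.

Lemma polyfunM f f' g g' : polyfun f f' -> polyfun g g' ->
  polyfun (fun P => f P * g P) (fun P => f' P * g P + f P * g' P).
Proof.
move=> [A [B h]] [A1 [B1 h1]].
exists (A * A1 + B * B1 * ('X^3 - 1)), (A * B1 + B * A1) => P P0.
have [-> ->] := h P P0; have [-> ->] := h1 P P0.
have e := curveE P0.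
by push_eval; split; ring: e.
Qed.

Lemma polyfunN f f' : polyfun f f' -> polyfun (fun P => - f P) (fun P => - f' P).
Proof.
move=> h; have [A [B e]] := polyfunM (polyfunC (-1)) h.
by exists A, B => P P0; have [<- <-] := e P P0; rewrite mul0r add0r !mulN1r.
Qed.

(** Evaluating at a point and at its opposite separates the two parts. *)
Lemma polyfun_parts0 (A B : {poly K}) (s : seq (E2 K)) :
  (forall P, P \notin s -> P != 0 -> A.[xc P] + B.[xc P] * yc P = 0) ->
  A = 0 /\ B = 0.
Proof.
move=> h; suff h2 x : x \notin [seq xc P | P <- s] -> A.[x] = 0 /\
    (B * ('X^3 - 1)).[x] = 0.
  have B0 : B * ('X^3 - 1) = 0 by apply: poly0_cofinite (fun x hx => (h2 x hx).2).
  split; first by apply: poly0_cofinite (fun x hx => (h2 x hx).1).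
  by apply: (@sqr_cubic0 _ 0 B 0); rewrite scale0r expr2 -mulrA B0 mulr0.
move=> xs; have [P P0 ex] := E2_point_over x.
have nPs Q : xc Q = x -> Q \notin s.
  by move=> eQ; apply: contra xs => hQ; apply/mapP; exists Q.
have h1 := h P (nPs P ex) P0.
have h3 := h (- P); rewrite xcN ycN ex in h3 h1; rewrite oppr_eq0 in h3.
have {}h3 := h3 (nPs _ (etrans (xcN P) ex)) P0.
have n2 : (2 : K) != 0 by rewrite pnatr_eq0.
have e := curveE P0; rewrite ex in e.
have A0 : A.[x] = 0.
  apply: (mulfI n2); rewrite mulr0 -[RHS](addr0 0) -{1}h1 -h3; ring.
rewrite A0 add0r in h1; split => //.
by push_eval; rewrite -e expr2 mulrA h1 mul0r.
Qed.

Lemma polyfun0 f f' (s : seq (E2 K)) : polyfun f f' ->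
  (forall P, P \notin s -> P != 0 -> f P = 0) -> forall P, P != 0 -> f P = 0.
Proof.
move=> [A [B h]] h0 P P0; have [-> _] := h P P0.
have [|-> ->] := @polyfun_parts0 A B s; last by push_eval; ring.
by move=> Q Qs Q0; have [<- _] := h Q Q0; apply: h0.
Qed.

(** [A^2 - B^2 (x^3 - 1)] is the norm of [A + B y] to [K[x]]: it turns zeros on
    the curve into roots of a polynomial, which are finite in number. *)
Lemma norm_neq0 (A B : {poly K}) P : P != 0 -> A.[xc P] + B.[xc P] * yc P != 0 ->
  A ^+ 2 - B ^+ 2 * ('X^3 - 1) != 0.
Proof.
move=> P0; apply: contraNneq => /eqP; rewrite subr_eq0 => /eqP e.
have B0 : B = 0 by apply: (@sqr_cubic0 _ A B 1); rewrite scale1r.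
move/eqP: e; rewrite B0 expr0n mul0r expf_eq0 => /eqP ->.
by push_eval; rewrite mul0r addr0.
Qed.

Lemma finite_over (s : seq K) : exists t : seq (E2 K), forall P, P \notin t ->
  P != 0 /\ xc P \notin s.
Proof.
elim: s => [|x s [t ht]]; first by exists [:: 0] => P; rewrite inE.
have [Q Q0 ex] := E2_point_over x.
exists [:: Q, - Q & t] => P; rewrite !inE !negb_or => /and3P[n1 n2 /ht [P0 xs]].
split=> //; rewrite xs andbT; apply/eqP => e.
have eP : val P = Some (x, yc P) by rewrite -e val_affine.
have eQ : val Q = Some (x, yc Q) by rewrite -ex val_affine.
have [e1|e1] := E2_same_abscissa eP eQ; first by rewrite e1 eqxx in n1.
by rewrite e1 E2_oppE eqxx in n2.
Qed.

Lemma polyfun_generic f f' P0 : polyfun f f' -> P0 != 0 -> f P0 != 0 ->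
  exists s : seq (E2 K), forall P, P \notin s -> P != 0 /\ f P != 0.
Proof.
move=> [A [B h]] P00; rewrite (h _ P00).1 => /(norm_neq0 P00) q0.
have [xs hxs] := poly_root_seq q0.
have [t ht] := finite_over xs; exists t => P /ht[Pn0 /hxs].
push_eval; rewrite -(curveE Pn0) => hq; split=> //; rewrite (h _ Pn0).1.
apply: contraNneq hq => e; apply/eqP.
transitivity ((A.[xc P] + B.[xc P] * yc P) * (A.[xc P] - B.[xc P] * yc P)).
  ring.
by rewrite e mul0r.
Qed.

(** ** Local behaviour at a point *)

(** Zariski neighbourhoods of [P0], cut out by a single function. *)
Definition near_pt P0 S := exists d d', [/\ polyfun d d', d P0 != 0 &
  forall P, P != 0 -> d P != 0 -> S P].

Lemma near_pt_generic P0 S : P0 != 0 -> near_pt P0 S ->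
  exists s : seq (E2 K), forall P, P \notin s -> P != 0 /\ S P.
Proof.
move=> P00 [d [d' [pd d0 h]]]; have [s hs] := polyfun_generic pd P00 d0.
by exists s => P /hs[Pn0 dP]; split=> //; apply: h.
Qed.

Lemma near_pt_at P0 S : P0 != 0 -> near_pt P0 S -> S P0.
Proof. by move=> P00 [d [d' [pd d0 h]]]; apply: h. Qed.

Lemma near_ptT P0 S : (forall P, P != 0 -> S P) -> near_pt P0 S.
Proof.
move=> h; exists (fun=> 1), (fun=> 0); split; first exact: polyfunC.
  exact: oner_neq0.
by move=> P Pn0 _; apply: h.
Qed.

Lemma near_ptS P0 S S' : (forall P, P != 0 -> S P -> S' P) ->
  near_pt P0 S -> near_pt P0 S'.
Proof.
by move=> h [d [d' [pd d0 hd]]]; exists d, d'; split=> // P *; apply/h/hd.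
Qed.

Lemma near_ptI P0 S S' : near_pt P0 S -> near_pt P0 S' ->
  near_pt P0 (fun P => S P /\ S' P).
Proof.
move=> [d [d' [pd d0 hd]]] [e [e' [pe e0 he]]].
exists (fun P => d P * e P), (fun P => d' P * e P + d P * e' P); split.
- exact: polyfunM.
- exact: mulf_neq0.
- by move=> P P0n; rewrite mulf_eq0 negb_or => /andP[? ?]; split; [apply: hd|apply: he].
Qed.

(** Rational functions [f] that are regular at [P0], with their derivative [g]:
    one quotient represents [f] wherever its denominator does not vanish. The
    behaviour of [f] at its other points is left open, so that [f] may be
    defined by cases. *)
Definition regular P0 f g := exists u u' v v',
  [/\ polyfun u u', polyfun v v', v P0 != 0 & forall P, P != 0 -> v P != 0 ->
    f P = u P / v P /\ g P = (u' P * v P - u P * v' P) / v P ^+ 2].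

Lemma polyfun_regular P0 f f' : polyfun f f' -> regular P0 f f'.
Proof.
move=> pf; exists f, f', (fun=> 1), (fun=> 0); split=> //; first exact: polyfunC.
  exact: oner_neq0.
by move=> P _ _; rewrite divr1 mulr1 mulr0 subr0 expr1n divr1.
Qed.

Lemma regular_congr P0 f g f1 g1 : regular P0 f g ->
  near_pt P0 (fun P => f1 P = f P /\ g1 P = g P) -> regular P0 f1 g1.
Proof.
move=> [u [u' [v [v' [pu pv v0 h]]]]] [d [d' [pd d0 hd]]].
exists (fun P => u P * d P), (fun P => u' P * d P + u P * d' P),
       (fun P => v P * d P), (fun P => v' P * d P + v P * d' P); split.
- exact: polyfunM.
- exact: polyfunM.
- exact: mulf_neq0.
move=> P P0n; rewrite mulf_eq0 negb_or => /andP[vP dP].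
have [-> ->] := hd P P0n dP; have [-> ->] := h P P0n vP.
by split; field; rewrite ?vP ?dP.
Qed.

Lemma regularD P0 f f' g g' : regular P0 f f' -> regular P0 g g' ->
  regular P0 (fun P => f P + g P) (fun P => f' P + g' P).
Proof.
move=> [u [u' [v [v' [pu pv v0 h]]]]] [r [r' [t [t' [pr pt t0 h1]]]]].
have pn := polyfunD (polyfunM pu pt) (polyfunM pr pv).
do 2 eexists; exists (fun P => v P * t P), (fun P => v' P * t P + v P * t' P); split.
- exact: pn.
- exact: polyfunM.
- exact: mulf_neq0.
move=> P P0n; rewrite mulf_eq0 negb_or => /andP[vP tP].
have [-> ->] := h1 P P0n tP; have [-> ->] := h P P0n vP.
by split; field; rewrite ?vP ?tP.
Qed.

Lemma regularM P0 f f' g g' : regular P0 f f' -> regular P0 g g' ->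
  regular P0 (fun P => f P * g P) (fun P => f' P * g P + f P * g' P).
Proof.
move=> [u [u' [v [v' [pu pv v0 h]]]]] [r [r' [t [t' [pr pt t0 h1]]]]].
have pn := polyfunM pu pr.
do 2 eexists; exists (fun P => v P * t P), (fun P => v' P * t P + v P * t' P); split.
- exact: pn.
- exact: polyfunM.
- exact: mulf_neq0.
move=> P P0n; rewrite mulf_eq0 negb_or => /andP[vP tP].
have [-> ->] := h1 P P0n tP; have [-> ->] := h P P0n vP.
by split; field; rewrite ?vP ?tP.
Qed.

Lemma regularC P0 (c : K) : regular P0 (fun=> c) (fun=> 0).
Proof. exact/polyfun_regular/polyfunC. Qed.

Lemma regularN P0 f f' : regular P0 f f' ->
  regular P0 (fun P => - f P) (fun P => - f' P).
Proof.
move=> h; apply: regular_congr (regularM (regularC P0 (-1)) h) _.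
by apply: near_ptT => P _; split; ring.
Qed.

Lemma regularB P0 f f' g g' : regular P0 f f' -> regular P0 g g' ->
  regular P0 (fun P => f P - g P) (fun P => f' P - g' P).
Proof. by move=> hf hg; apply: regularD hf (regularN hg). Qed.

Lemma regular_neq0 P0 f f' : P0 != 0 -> regular P0 f f' -> f P0 != 0 ->
  near_pt P0 (fun P => f P != 0).
Proof.
move=> P00 [u [u' [v [v' [pu pv v0 h]]]]].
rewrite (h _ P00 v0).1 mulf_eq0 invr_eq0 (negbTE v0) orbF => u0.
exists (fun P => u P * v P), (fun P => u' P * v P + u P * v' P); split.
- exact: polyfunM.
- exact: mulf_neq0.
move=> P P0n; rewrite mulf_eq0 negb_or => /andP[uP vP].
by rewrite (h _ P0n vP).1 mulf_neq0 // invr_eq0.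
Qed.

Lemma regularV P0 f f' : P0 != 0 -> regular P0 f f' -> f P0 != 0 ->
  regular P0 (fun P => (f P)^-1) (fun P => - f' P / f P ^+ 2).
Proof.
move=> P00 [u [u' [v [v' [pu pv v0 h]]]]].
rewrite (h _ P00 v0).1 mulf_eq0 invr_eq0 (negbTE v0) orbF => u0.
exists (fun P => v P * v P), (fun P => v' P * v P + v P * v' P),
  (fun P => u P * v P), (fun P => u' P * v P + u P * v' P); split.
- exact: polyfunM.
- exact: polyfunM.
- exact: mulf_neq0.
move=> P P0n; rewrite mulf_eq0 negb_or => /andP[uP vP].
have [-> ->] := h P P0n vP.
by split; field; rewrite uP vP.
Qed.

Lemma regular_div P0 f f' g g' : P0 != 0 -> regular P0 f f' -> regular P0 g g' ->
  g P0 != 0 ->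
  regular P0 (fun P => f P / g P) (fun P => (f' P - f P / g P * g' P) / g P).
Proof.
move=> P00 hf hg g0; apply: regular_congr (regularM hf (regularV P00 hg g0)) _.
apply: near_ptS (regular_neq0 P00 hg g0) => P _ gP; split=> //.
by field; rewrite gP.
Qed.

Lemma regularX P0 f f' n : regular P0 f f' ->
  regular P0 (fun P => f P ^+ n.+1) (fun P => n.+1%:R * f P ^+ n * f' P).
Proof.
move=> hf; elim: n => [|n IH].
  by apply: regular_congr hf _; apply: near_ptT => P _; rewrite expr1 expr0; split; ring.
apply: regular_congr (regularM hf IH) _; apply: near_ptT => P _.
by split; rewrite ?exprS // -[n.+2%:R]natr1; ring.
Qed.

Lemma regular_horner P0 f f' (p : {poly K}) : regular P0 f f' ->
  regular P0 (fun P => p.[f P]) (fun P => p^`().[f P] * f' P).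
Proof.
move=> hf; elim/poly_ind: p => [|p c IH].
  by apply: regular_congr (regularC P0 0) _; apply: near_ptT => P _; push_eval; split; ring.
apply: regular_congr (regularD (regularM IH hf) (regularC P0 c)) _.
by apply: near_ptT => P _; push_eval; split; ring.
Qed.

Lemma regular_eq P0 f f' g g' (s : seq (E2 K)) : P0 != 0 ->
  regular P0 f f' -> regular P0 g g' ->
  (forall P, P \notin s -> P != 0 -> f P = g P) -> f P0 = g P0.
Proof.
move=> P00 [u [u' [v [v' [pu pv v0 h]]]]] [r [r' [t [t' [pr pt t0 h1]]]]] e.
have pn := polyfunD (polyfunM pu pt) (polyfunN (polyfunM pr pv)).
have [sd hd] := polyfun_generic (polyfunM pv pt) P00 (mulf_neq0 v0 t0).
have e0 : u P0 * t P0 - r P0 * v P0 = 0.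
  apply: (polyfun0 (s := s ++ sd) pn) => // P.
  rewrite mem_cat negb_or => /andP[Ps /hd[Pn0]].
  rewrite mulf_eq0 negb_or => /andP[vP tP] _; have := e P Ps Pn0.
  rewrite (h _ Pn0 vP).1 (h1 _ Pn0 tP).1 => /eqP; rewrite eqr_div // => /eqP ->.
  by rewrite subrr.
rewrite (h _ P00 v0).1 (h1 _ P00 t0).1.
by apply/eqP; rewrite eqr_div // -subr_eq0 e0.
Qed.

(** With [u / v] rationalised as [(C + D y) / q], the derivative splits into that
    of [C / q] and that of [D y / q]. Both vanish, so [C / q] is constant, and
    so is the square [D^2 (x^3 - 1) / q^2] of the other part, which has odd
    order at infinity unless [D = 0]. *)
Lemma regular_constant P0 f f' : P0 != 0 -> regular P0 f f' ->
  near_pt P0 (fun P => f' P = 0) -> near_pt P0 (fun P => f P = f P0).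
Proof.
move=> P00 [u [u' [v [v' [pu pv v0 h]]]]] /(near_pt_generic P00)[s hs].
have [s1 hs1] := polyfun_generic pv P00 v0.
have pu2 := pu; have pv2 := pv.
move: pu pv => [A1 [B1 h1]] [A2 [B2 h2]].
pose q := A2 ^+ 2 - B2 ^+ 2 * ('X^3 - 1).
have q0 : q != 0 by apply: (norm_neq0 P00); rewrite -(h2 _ P00).1.
pose C := A1 * A2 - B1 * B2 * ('X^3 - 1); pose D := B1 * A2 - A1 * B2.
have [] := @polyfun_parts0
   ((2 *: ('X^3 - 1) * D^`() + 3 *: 'X^2 * D) * q - 2 *: (D * q^`() * ('X^3 - 1)))
   (2 *: (C^`() * q - C * q^`())) (s ++ s1).
  move=> P; rewrite mem_cat negb_or => /andP[/hs[Pn0 f0] /hs1[_ vP]] _.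
  have /eqP := f0; rewrite (h _ Pn0 vP).2 mulf_eq0 invr_eq0 expf_eq0 /=.
  rewrite (negbTE vP) orbF (h1 _ Pn0).1 (h1 _ Pn0).2 (h2 _ Pn0).1 (h2 _ Pn0).2.
  move=> /eqP e0; have e := curveE Pn0; rewrite /q /C /D; push_eval.
  transitivity ((A2.[xc P] - B2.[xc P] * yc P) ^+ 2 * 0); last by rewrite mulr0.
  by rewrite -[in RHS]e0; ring: e.
move=> eD /eqP; rewrite scaler_eq0 pnatr_eq0 subr_eq0 /= => /eqP eC.
have [a ea] := wronskian0 q0 eC.
have D0 : D = 0.
  have [||b eb] := @wronskian0 _ (D ^+ 2 * ('X^3 - 1)) (q ^+ 2).
  - by rewrite expf_neq0.
  - apply: subr0_eq; transitivity (q * D * 0); last by rewrite mulr0.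
    rewrite -[in RHS]eD !deriv_exp !(derivM, derivB, derivXn, derivC).
    rewrite -!mul_polyC /=; ring.
  by apply: (@sqr_cubic0 _ q D b).
have eu P : P != 0 -> u P - a * v P = 0.
  have [sq hsq] := poly_root_seq q0; have [t ht] := finite_over sq.
  apply: (polyfun0 (s := t) (polyfunD pu2 (polyfunN (polyfunM (polyfunC a) pv2)))).
  move=> {}P /ht[Pn0 /hsq qP] _; apply/eqP; move: qP; apply: contraNT => nz.
  have e := curveE Pn0; rewrite (h1 _ Pn0).1 (h2 _ Pn0).1 in nz.
  have w0 : A2.[xc P] - B2.[xc P] * yc P = 0.
    apply/eqP; rewrite -(mulrI_eq0 _ (mulfI nz)); apply/eqP.
    transitivity ((C - a *: q).[xc P] + D.[xc P] * yc P); last first.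
      by rewrite ea subrr D0; push_eval; ring.
    by rewrite /C /D /q; push_eval; ring: e.
  apply/eqP; transitivity ((A2.[xc P] - B2.[xc P] * yc P) * (A2.[xc P] + B2.[xc P] * yc P)).
    by rewrite /q; push_eval; ring: e.
  by rewrite w0 mul0r.
have ef P : P != 0 -> v P != 0 -> f P = a.
  move=> Pn0 vP; rewrite (h _ Pn0 vP).1; move/eqP: (eu P Pn0).
  by rewrite subr_eq0 => /eqP ->; rewrite mulfK.
by exists v, v'; split=> // P Pn0 vP; rewrite !ef.
Qed.
End Functions.
Arguments xc {K} P.
Arguments yc {K} P.

(** * Maps with a constant multiplier on the invariant differential *)

Section RegularMaps.
Variable K : numClosedFieldType.
Implicit Types (P Q : E2 K) (f g u v d : E2 K -> K) (S : E2 K -> Prop).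
Implicit Types (Phi Psi : E2 K -> E2 K) (l m : K).

(** Chords and tangents are treated together: the slope solves two equations,
    and unless the points are opposite one of them determines it, with a
    denominator that does not vanish nearby. *)
Lemma add_slope P Q l : P != 0 -> Q != 0 ->
  (xc Q - xc P != 0) || (yc P + yc Q != 0) ->
  l * (xc Q - xc P) = yc Q - yc P ->
  l * (yc P + yc Q) = xc P ^+ 2 + xc P * xc Q + xc Q ^+ 2 ->
  let x3 := l ^+ 2 - xc P - xc Q in
  [/\ P + Q != 0, xc (P + Q) = x3 & yc (P + Q) = l * (xc P - x3) - yc P].
Proof.
move=> P0 Q0 nd e1 e2 x3; apply: xyc_some.
rewrite -E2_addE val_E2_add (val_affine P0) (val_affine Q0) /=.
case: (eqVneq (xc P) (xc Q)) => [ex|nx] /=; last first.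
  have d : xc Q - xc P != 0 by rewrite subr_eq0 eq_sym.
  by rewrite -e1 mulfK.
rewrite -ex subrr eqxx /= in nd e1 e2 *.
rewrite addr_eq0 in nd; rewrite (negbTE nd).
have ey : yc Q = yc P by apply/eqP; rewrite -subr_eq0 -e1 mulr0.
rewrite ey in nd e2 *.
have y0 : 2 * yc P != 0 by rewrite mulr_natl mulr2n addr_eq0.
have -> : 3 * xc P ^+ 2 / (2 * yc P) = l.
  apply: (mulIf y0); rewrite divfK //.
  transitivity (l * (yc P + yc P)); last by ring.
  by rewrite e2; ring.
by rewrite /chord_point /x3 ex.
Qed.

(** Maps that are regular at [P0], with an affine value there, and under which
    the pullback of the invariant differential [dx / (2 y)] is [l] times
    itself. *)
Definition regmap l P0 Phi :=
  [/\ P0 != 0, near_pt P0 (fun P => Phi P != 0),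
      regular P0 (xc \o Phi) (fun P => 2 * l * yc (Phi P)) &
      regular P0 (yc \o Phi) (fun P => 3 * l * xc (Phi P) ^+ 2)].

Lemma regmap_at l P0 Phi : regmap l P0 Phi -> Phi P0 != 0.
Proof. by case=> P00 h _ _; apply: near_pt_at P00 h. Qed.

Lemma regmap_id P0 : P0 != 0 -> regmap 1 P0 id.
Proof.
move=> P00; split=> //; first exact: near_ptT.
- apply: regular_congr (polyfun_regular P0 (polyfun_x K)) _.
  by apply: near_ptT => P _ /=; split=> //; ring.
- apply: regular_congr (polyfun_regular P0 (polyfun_y K)) _.
  by apply: near_ptT => P _ /=; split=> //; ring.
Qed.

Lemma regmap_cst P0 Q : P0 != 0 -> Q != 0 -> regmap 0 P0 (fun=> Q).
Proof.
move=> P00 Q0; split=> //; first exact: near_ptT.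
- apply: regular_congr (regularC P0 (xc Q)) _.
  by apply: near_ptT => P _ /=; split=> //; ring.
- apply: regular_congr (regularC P0 (yc Q)) _.
  by apply: near_ptT => P _ /=; split=> //; ring.
Qed.

Lemma regmapN l P0 Phi : regmap l P0 Phi -> regmap (- l) P0 (fun P => - Phi P).
Proof.
move=> [P00 h hx hy]; split=> //.
- by apply: near_ptS h => P _; rewrite oppr_eq0.
- apply: regular_congr hx _; apply: near_ptT => P _ /=; rewrite xcN ycN.
  by split=> //; ring.
- apply: regular_congr (regularN hy) _; apply: near_ptT => P _ /=; rewrite xcN ycN.
  by split=> //; ring.
Qed.

(** This is the invariance of [dx / (2 y)] under translations. The sum is regular
    also where the summands agree, by the second formula for the slope. *)
Lemma regmapD l m P0 Phi Psi : regmap l P0 Phi -> regmap m P0 Psi ->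
  Phi P0 + Psi P0 != 0 -> regmap (l + m) P0 (fun P => Phi P + Psi P).
Proof.
move=> hPhi hPsi; have F0 := regmap_at hPhi; have G0 := regmap_at hPsi.
case: hPhi hPsi => P00 nF xF yF [_ nG xG yG] S0.
have nFG := near_ptI nF nG.
have key (L L' : E2 K -> K) : regular P0 L L' ->
    near_pt P0 (fun P => [/\ Phi P != 0 /\ Psi P != 0,
      (xc (Psi P) - xc (Phi P) != 0) || (yc (Phi P) + yc (Psi P) != 0),
      L P * (xc (Psi P) - xc (Phi P)) = yc (Psi P) - yc (Phi P),
      L P * (yc (Phi P) + yc (Psi P)) =
        xc (Phi P) ^+ 2 + xc (Phi P) * xc (Psi P) + xc (Psi P) ^+ 2 &
      let x3 := L P ^+ 2 - xc (Phi P) - xc (Psi P) in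
      let y3 := L P * (xc (Phi P) - x3) - yc (Phi P) in
      2 * L P * L' P - 2 * l * yc (Phi P) - 2 * m * yc (Psi P) = 2 * (l + m) * y3 /\
      L' P * (xc (Phi P) - x3) + L P * (2 * l * yc (Phi P) - 2 * (l + m) * y3)
        - 3 * l * xc (Phi P) ^+ 2 = 3 * (l + m) * x3 ^+ 2]) ->
    regmap (l + m) P0 (fun P => Phi P + Psi P).
  move=> rL nL; have rL2 := regularX 1 rL.
  have rx3 := regularB (regularB rL2 xF) xG.
  have ry3 := regularB (regularM rL (regularB xF rx3)) yF.
  split=> //.
  - by apply: near_ptS nL => P _ [[h1 h2] h3 h4 h5 _]; case: (add_slope h1 h2 h3 h4 h5).
  - apply: regular_congr rx3 _; apply: near_ptS nL => P _ /= [[h1 h2] h3 h4 h5 [h6 h7]].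
    by case: (add_slope h1 h2 h3 h4 h5) => _ -> ->; rewrite -h6 expr1.
  - apply: regular_congr ry3 _; apply: near_ptS nL => P _ /= [[h1 h2] h3 h4 h5 [h6 h7]].
    case: (add_slope h1 h2 h3 h4 h5) => _ -> ->; rewrite -h7 -h6 expr1.
    by split=> //; ring.
case: (eqVneq (xc (Psi P0) - xc (Phi P0)) 0) => [ex|nx]; last first.
  have rd := regular_div P00 (regularB yG yF) (regularB xG xF) nx.
  apply: (key _ _ rd); apply: near_ptS (near_ptI nFG (regular_neq0 P00 (regularB xG xF) nx)).
  move=> P _ /= [[Fn Gn] d]; have c1 := curveE Fn; have c2 := curveE Gn.
  split=> //; first by rewrite d.
  - by rewrite divfK.
  - by field: c1 c2; rewrite d.
  - by split; field: c1 c2; rewrite d.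
have ny : yc (Phi P0) + yc (Psi P0) != 0.
  apply: contraNneq S0 => ey; rewrite addr_eq0; apply/eqP/xyc_inj => //.
  - by rewrite oppr_eq0.
  - by rewrite xcN; apply/esym/subr0_eq.
  - by rewrite ycN; apply/eqP; rewrite -addr_eq0 ey.
have rn := regularD (regularD (regularX 1 xF) (regularM xF xG)) (regularX 1 xG).
have rd := regular_div P00 rn (regularD yF yG) ny.
apply: (key _ _ rd); apply: near_ptS (near_ptI nFG (regular_neq0 P00 (regularD yF yG) ny)).
move=> P _ /= [[Fn Gn] d]; have c1 := curveE Fn; have c2 := curveE Gn.
split=> //; first by rewrite d orbT.
- by field: c1 c2; rewrite d.
- by rewrite divfK.
- by rewrite !expr1; split; field: c1 c2; rewrite d.
Qed.

Lemma regmapB l m P0 Phi Psi : regmap l P0 Phi -> regmap m P0 Psi ->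
  Phi P0 - Psi P0 != 0 -> regmap (l - m) P0 (fun P => Phi P - Psi P).
Proof. by move=> hF hG h; apply: regmapD hF (regmapN hG) h. Qed.

Lemma regmap_constant P0 Phi : regmap 0 P0 Phi ->
  exists s : seq (E2 K), forall P, P \notin s -> P != 0 /\ Phi P = Phi P0.
Proof.
move=> h; have F0 := regmap_at h; case: h => P00 nF xF yF.
have nx := regular_constant P00 xF (near_ptT _ _).
have ny := regular_constant P00 yF (near_ptT _ _).
have [||s hs] := near_pt_generic P00 (near_ptI nF (near_ptI (nx _) (ny _))).
- by move=> P _; ring.
- by move=> P _; ring.
by exists s => P /hs[Pn0 [FP [ex ey]]]; split=> //; apply: xyc_inj.
Qed.

End RegularMaps.

(** * The endomorphism attached to a solution of the differential equation *)

Section Rotation.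
Variable K : numClosedFieldType.
Implicit Types (P Q : E2 K) (w : K).

Definition rot_raw w (p : option (K * K)) : option (K * K) :=
  if p is Some (x, y) then Some (w * x, - y) else None.

Lemma onE2_rot w p : w ^+ 3 = 1 -> onE2 p -> onE2 (rot_raw w p).
Proof. by case: p => [[x y]|] //= w3; rewrite sqrrN exprMn w3 mul1r. Qed.

Definition rot w (w3 : w ^+ 3 = 1) P : E2 K :=
  exist (fun p => onE2 p) (rot_raw w (val P)) (onE2_rot w3 (valP P)).

Lemma rot_neq0 w (w3 : w ^+ 3 = 1) P : (rot w3 P != 0) = (P != 0).
Proof. by rewrite -!(inj_eq val_inj) /=; case: (val P) => [[]|]. Qed.

Lemma xc_rot w (w3 : w ^+ 3 = 1) P : xc (rot w3 P) = w * xc P.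
Proof. by rewrite /xc /=; case: (val P) => [[]|]; rewrite ?mulr0. Qed.

Lemma yc_rot w (w3 : w ^+ 3 = 1) P : yc (rot w3 P) = - yc P.
Proof. by rewrite /yc /=; case: (val P) => [[]|]; rewrite ?oppr0. Qed.

Lemma cube_root_of_unity : exists2 w : K, w ^+ 3 = 1 & w ^+ 2 + w + 1 = 0.
Proof.
pose r : K := sqrtC (- 3); have r2 : r ^+ 2 = - 3 by rewrite sqrtCK.
have n2 : (2 : K) != 0 by rewrite pnatr_eq0.
by exists ((r - 1) / 2); apply: subr0_eq; field: r2.
Qed.

(** In the endomorphism ring, the two rotations are the primitive sixth roots of
    unity [e] and [e^-1], and [e + e^-1 = 1]. *)
Lemma rotD w (w3 : w ^+ 3 = 1) (v3 : (w ^+ 2) ^+ 3 = 1) P :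
  w ^+ 2 + w + 1 = 0 -> rot w3 P + rot v3 P = P.
Proof.
move=> w1; case: (eqVneq P 0) => [->|P0].
  by rewrite -[RHS]addr0; congr (_ + _); apply: val_inj.
have P1 : rot w3 P != 0 by rewrite rot_neq0.
have P2 : rot v3 P != 0 by rewrite rot_neq0.
have e := curveE P0.
have n2 : (2 : K) != 0 by rewrite pnatr_eq0.
have ew : w ^+ 2 = - w - 1 by rewrite -[RHS]addr0 -w1; ring.
have [|||] := @add_slope _ (rot w3 P) (rot v3 P) 0 P1 P2.
- rewrite !xc_rot !yc_rot -mulrBl mulf_eq0 negb_or; case: (eqVneq (xc P) 0) => x0.
    rewrite -opprD oppr_eq0 -mulr2n mulrn_eq0 /= andbF /=.
    apply: contraTneq isT => y0; move: e; rewrite x0 y0 !expr0n sub0r => /eqP.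
    by rewrite eq_sym oppr_eq0 oner_eq0.
  rewrite andbT subr_eq0; apply/orP; left; apply/eqP => e2.
  have h1 : 2 * w + 1 = 0 by rewrite -w1 e2; ring.
  have /eqP : (3 : K) = 0.
    transitivity (4 * (w ^+ 2 + w + 1) - (2 * w + 1) ^+ 2); first by ring.
    by rewrite w1 h1; ring.
  by rewrite pnatr_eq0.
- by rewrite !xc_rot !yc_rot mul0r subrr.
- by rewrite !xc_rot mul0r; ring: ew.
rewrite !xc_rot !yc_rot => nz ex ey; apply: xyc_inj => //.
- by rewrite ex; ring: ew.
- by rewrite ey; ring.
Qed.
End Rotation.

Section Isogeny.
Variable K : numClosedFieldType.
Variables (N D B : {poly K}) (c : K).
Hypotheses (copND : coprimep N D) (D0 : D != 0) (c0 : c != 0).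
Hypothesis defB : B = N * D + 3 *: 'X * (N^`() * D - N * D^`()).
Hypothesis ode : c ^+ 2 *: (B ^+ 2 * ('X - 1)) = D * ('X * N ^+ 3 - D ^+ 3).
Implicit Types (P Q W Z : E2 K).

(** [B = 0] would mean [X N^3 = D^3], hence [X] would divide both [N] and [D]. *)
Lemma ode_neq0 : B != 0.
Proof.
apply: contraTneq isT => B0; move: ode.
rewrite B0 expr0n mul0r scaler0 => /esym/eqP; rewrite mulf_eq0 (negbTE D0) /=.
rewrite subr_eq0 => /eqP e.
have rD : root D 0.
  have := congr1 (horner^~ 0) e; rewrite /root; push_eval; rewrite mul0r.
  by move/esym/eqP; rewrite expf_eq0.
have /factor_theorem[D1 eD] := rD.
have X0 : ('X : {poly K}) != 0 by rewrite polyX_eq0.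
have e2 : N ^+ 3 = 'X ^+ 2 * D1 ^+ 3.
  by apply: (mulfI X0); rewrite e eD subr0; ring.
have rN : root N 0.
  have := congr1 (horner^~ 0) e2.
  push_eval; rewrite expr0n mul0r.
  by move/eqP; rewrite expf_eq0.
by have := coprimep_root copND rN; rewrite -[_ == 0]/(root D 0) rD.
Qed.

(** Obtained by differentiating [ode] and cancelling [B]; it says that the
    second coordinate [phi_y] has the derivative required by the equation of the
    curve, even where that coordinate vanishes. *)
Lemma ode2 : c ^+ 2 *: (B * D + 2 *: (('X - 1) * (B^`() * D - 2 *: (B * D^`())))) =
  N ^+ 2 * D.
Proof.
apply: (mulfI ode_neq0).
have e2 := congr1 (@deriv K) ode.
transitivity (D * (c ^+ 2 *: (B ^+ 2 * ('X - 1)))^`() - 4 *: (D^`() * (c ^+ 2 *: (B ^+ 2 * ('X - 1))))).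
  rewrite derivZ derivM deriv_exp derivB derivX derivC -!mul_polyC /=; ring.
rewrite ode derivM derivB derivM !deriv_exp derivX defB -!mul_polyC /=.
ring.
Qed.

Definition phi_x (x : K) : K := x * N.[x ^+ 3] / D.[x ^+ 3].
Definition phi_y (x y : K) : K := c * y * B.[x ^+ 3] / D.[x ^+ 3] ^+ 2.

Lemma phi_on x y : y ^+ 2 = x ^+ 3 - 1 -> D.[x ^+ 3] != 0 ->
  phi_y x y ^+ 2 = phi_x x ^+ 3 - 1.
Proof.
move=> e d; have /(congr1 (horner^~ (x ^+ 3))) := ode; push_eval => e2.
rewrite /phi_x /phi_y.
transitivity (c ^+ 2 * (B.[x ^+ 3] ^+ 2 * (x ^+ 3 - 1)) / D.[x ^+ 3] ^+ 4).
  by rewrite -e; field.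
by rewrite e2; field.
Qed.

(** The default value of [insubd] is not taken, by [phi_on]. *)
Definition phi P : E2 K :=
  if val P is Some (x, y) then
    if D.[x ^+ 3] == 0 then E2_zero K
    else insubd (E2_zero K) (Some (phi_x x, phi_y x y))
  else E2_zero K.

Lemma phi_pole P : P != 0 -> D.[xc P ^+ 3] = 0 -> phi P = 0.
Proof. by move=> /val_affine e d; rewrite /phi e d eqxx. Qed.

Lemma phi0 : phi 0 = 0. Proof. by []. Qed.

Lemma phi_val P : P != 0 -> D.[xc P ^+ 3] != 0 ->
  val (phi P) = Some (phi_x (xc P), phi_y (xc P) (yc P)).
Proof.
move=> P0 d; rewrite /phi (val_affine P0) (negbTE d) val_insubd ifT //=.
by apply/eqP/phi_on => //; apply: curveE.
Qed.

Lemma phi_affine P : P != 0 -> D.[xc P ^+ 3] != 0 ->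
  [/\ phi P != 0, xc (phi P) = phi_x (xc P) & yc (phi P) = phi_y (xc P) (yc P)].
Proof. by move=> P0 d; apply/xyc_some/phi_val. Qed.

Lemma phi_neq0 P : phi P != 0 -> P != 0 /\ D.[xc P ^+ 3] != 0.
Proof.
case: (eqVneq P 0) => [->|P0]; first by rewrite phi0 eqxx.
by case: (eqVneq D.[xc P ^+ 3] 0) => [/(phi_pole P0) ->|//]; rewrite eqxx.
Qed.

Lemma phiN P : phi (- P) = - phi P.
Proof.
case: (eqVneq P 0) => [->|P0]; first by rewrite !(oppr0, phi0).
have N0 : - P != 0 by rewrite oppr_eq0.
case: (eqVneq D.[xc P ^+ 3] 0) => d.
  by rewrite !phi_pole ?oppr0 // xcN.
have [F0 ex ey] := phi_affine P0 d.
have := @phi_affine (- P) N0; rewrite xcN ycN => /(_ d)[G0 gx gy].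
apply: xyc_inj; rewrite ?oppr_eq0 // ?xcN ?ycN ?ex ?ey //.
by rewrite gy /phi_y; ring.
Qed.

Lemma phi_rot w (w3 : w ^+ 3 = 1) P : phi (rot w3 P) = rot w3 (phi P).
Proof.
have r0 : rot w3 0 = 0 by apply: val_inj.
case: (eqVneq P 0) => [->|P0]; first by rewrite phi0 r0 phi0.
have R0 : rot w3 P != 0 by rewrite rot_neq0.
case: (eqVneq D.[xc P ^+ 3] 0) => d.
  by rewrite !phi_pole // xc_rot exprMn w3 mul1r.
have [F0 ex ey] := phi_affine P0 d.
have := @phi_affine _ R0.
rewrite xc_rot yc_rot exprMn w3 mul1r => /(_ d)[G0 gx gy].
apply: xyc_inj; rewrite ?rot_neq0 // ?xc_rot ?yc_rot ?ex ?ey ?gx ?gy.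
  by rewrite /phi_x exprMn w3 mul1r !mulrA.
by rewrite /phi_y exprMn w3 mul1r; ring.
Qed.

Lemma phi_generic : exists s : seq (E2 K), forall P, P \notin s -> phi P != 0.
Proof.
have D3 : D \Po 'X^3 != 0.
  apply: contraNneq D0 => e; apply/eqP/(@poly0_cofinite _ D [::]) => z _.
  have [P _ ex] := E2_point_over (3.-root z).
  have <- : xc P ^+ 3 = z by rewrite ex rootCK.
  by have := congr1 (horner^~ (xc P)) e; rewrite horner_comp; push_eval.
have [xs hxs] := poly_root_seq D3; have [s hs] := finite_over xs.
exists s => P /hs[P0 /hxs]; rewrite horner_comp; push_eval => d.
by case: (phi_affine P0 d).
Qed.

(** [phi_y] is [c] times [y] times the derivative of [phi_x], and [ode2] gives
    the derivative of [phi_y] itself. *)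
Lemma regmap_phi l P0 Phi : regmap l P0 Phi -> phi (Phi P0) != 0 ->
  regmap (l / c) P0 (phi \o Phi).
Proof.
move=> [P00 nF xF yF] /phi_neq0[F0 d0].
have rX3 := regularX 2 xF.
have rD := regular_horner D rX3; have rN := regular_horner N rX3.
have rB := regular_horner B rX3.
have nD := near_ptI nF (regular_neq0 P00 rD d0).
have rx := regular_div P00 (regularM xF rN) rD d0.
have ry := regular_div P00 (regularM (regularM (regularC P0 c) yF) rB) (regularX 1 rD) (expf_neq0 2 d0).
split=> //.
- by apply: near_ptS nD => P _ /= [h d]; case: (phi_affine h d).
- apply: regular_congr rx _; apply: near_ptS nD => P _ /= [h d].
  have [_ -> ->] := phi_affine h d; split=> //.
  by rewrite /phi_y defB; push_eval; field; rewrite d c0.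
- apply: regular_congr ry _; apply: near_ptS nD => P _ /= [h d].
  have [_ -> ->] := phi_affine h d; split=> //.
  have e := curveE h.
  have := congr1 (horner^~ (xc (Phi P) ^+ 3)) ode2; push_eval => e2.
  rewrite /phi_x.
  transitivity (3 * (l / c) * xc (Phi P) ^+ 2 * (N.[xc (Phi P) ^+ 3] ^+ 2 * D.[xc (Phi P) ^+ 3]) / D.[xc (Phi P) ^+ 3] ^+ 3).
    by field; rewrite d c0.
  by rewrite -e2 -e; field; rewrite d c0.
Qed.

(** The map taking [P] to [phi P + phi (Q - P)] has multiplier zero, so it is
    constant, and its value is known at the base point [P = rot w3 Q]: there
    [P] and [Q - P] are both rotations of [Q], which commute with [phi]. *)
Lemma phi_split_affine Q : phi Q != 0 ->
  exists s : seq (E2 K), forall P, P \notin s -> phi P + phi (Q - P) = phi Q.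
Proof.
move=> F0; have [Q0 _] := phi_neq0 F0.
have [w w3 w1] := cube_root_of_unity K.
have v3 : (w ^+ 2) ^+ 3 = 1 by rewrite exprAC w3 expr1n.
have eQ : Q - rot w3 Q = rot v3 Q by rewrite -{1}(rotD w3 v3 Q w1) addrC addKr.
have R0 : rot w3 Q != 0 by rewrite rot_neq0.
have hid := regmap_id R0.
have hsub := regmapB (regmap_cst R0 Q0) hid; rewrite /= eQ rot_neq0 in hsub.
have h1 := regmap_phi hid; rewrite /= phi_rot rot_neq0 in h1.
have h2 := regmap_phi (hsub Q0); rewrite /= eQ phi_rot rot_neq0 in h2.
have := regmapD (h1 F0) (h2 F0); rewrite /= eQ !phi_rot rotD // => /(_ F0).
rewrite sub0r mulN1r mul1r subrr => /regmap_constant[s hs].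
by exists s => P /hs[_]; rewrite /= eQ !phi_rot rotD.
Qed.

(** In lowest terms the denominator of [phi_x] vanishes at [Q] and its numerator
    does not; when the pole lies at [x = 0], a factor [x] has to be cancelled
    first. *)
Lemma phi_pole_irregular m Q Phi (s : seq (E2 K)) : phi Q = 0 ->
  regmap m Q Phi -> ~ (forall P, P \notin s -> phi P = Phi P).
Proof.
move=> FQ [Q0 _ xF _] e.
have dQ : D.[xc Q ^+ 3] = 0.
  by apply/eqP; apply: contraT => d; case: (phi_affine Q0 d); rewrite FQ eqxx.
have nQ : N.[xc Q ^+ 3] != 0.
  by apply: (@coprimep_root _ D N); rewrite 1?coprimep_sym //; apply/eqP.
have [t ht] := phi_generic.
have rX := polyfun_regular Q (polyfun_x K); have rX3 := regularX 2 rX.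
have e1 : D.[xc Q ^+ 3] * xc (Phi Q) = xc Q * N.[xc Q ^+ 3].
  apply: (regular_eq (s := s ++ t) Q0 (regularM (regular_horner D rX3) xF)
     (regularM rX (regular_horner N rX3))) => P.
  rewrite mem_cat negb_or => /andP[/e eP /ht FP] _ /=.
  have [P0 d] := phi_neq0 FP; have [_ ex _] := phi_affine P0 d.
  by rewrite -eP ex /phi_x; field.
move/esym/eqP: e1; rewrite dQ mul0r mulf_eq0 (negbTE nQ) orbF => /eqP xQ.
rewrite xQ expr0n /= in dQ nQ.
have /factor_theorem[D1 eD] : root D 0 by apply/eqP.
have e2 : xc Q ^+ 2 * D1.[xc Q ^+ 3] * xc (Phi Q) = N.[xc Q ^+ 3].
  have [u hu] := finite_over [:: 0 : K].
  apply: (regular_eq (s := s ++ t ++ u) Q0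
     (regularM (regularM (regularX 1 rX) (regular_horner D1 rX3)) xF)
     (regular_horner N rX3)) => P.
  rewrite !mem_cat !negb_or => /and3P[/e eP /ht FP /hu[_]] + _ /=.
  rewrite inE => x0; have [P0 d] := phi_neq0 FP.
  have [_ ex _] := phi_affine P0 d; move: d.
  rewrite -eP ex /phi_x eD !(hornerM, hornerXsubC) subr0 => d.
  have := d; rewrite mulf_eq0 negb_or => /andP[d1 _].
  by field; rewrite d1 x0.
by move: nQ; rewrite xQ !expr0n /= !mul0r in e2; rewrite -e2 eqxx.
Qed.

(** Otherwise [phi Z = phi W - phi (W - Z)] would be regular at [Z = Q]. *)
Lemma phi_split_pole Q : phi Q = 0 ->
  exists s : seq (E2 K), forall P, P \notin s -> phi P + phi (Q - P) = phi Q.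
Proof.
move=> FQ; rewrite FQ; case: (eqVneq Q 0) => [->|Q0].
  by exists [::] => P _; rewrite sub0r phiN subrr.
have [t ht] := phi_generic.
exists (t ++ [seq P + Q | P <- t]) => W.
rewrite mem_cat negb_or => /andP[/ht FW nW].
have FWQ : phi (W - Q) != 0.
  by apply: ht; apply: contra nW => h; apply/mapP; exists (W - Q); rewrite ?subrK.
have [W0 _] := phi_neq0 FW; have [WQ0 _] := phi_neq0 FWQ.
rewrite -opprB phiN; apply/eqP; apply: contraT => nz.
have h1 := regmapB (regmap_cst Q0 W0) (regmap_id Q0) WQ0.
have h2 := regmapB (regmap_cst Q0 FW) (regmap_phi h1 FWQ) nz.
have [s hs] := phi_split_affine FW.
case: (phi_pole_irregular (s := s) FQ h2) => P /hs <- /=.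
by rewrite addrK.
Qed.

Lemma phi_split Q :
  exists s : seq (E2 K), forall P, P \notin s -> phi P + phi (Q - P) = phi Q.
Proof.
case: (eqVneq (phi Q) 0) => h; first exact: phi_split_pole.
exact: phi_split_affine.
Qed.

(** For generic [W], split off [W] from [P + Q] and from [P], and [W - P] from
    [Q]. *)
Theorem phiD P Q : phi (P + Q) = phi P + phi Q.
Proof.
have [s1 h1] := phi_split (P + Q); have [s2 h2] := phi_split P.
have [s3 h3] := phi_split Q.
have [W] := E2_infinite (s1 ++ s2 ++ [seq T + P | T <- s3]).
rewrite !mem_cat !negb_or => /and3P[n1 n2 n3].
have {}n3 : W - P \notin s3.
  by apply: contra n3 => h; apply/mapP; exists (W - P); rewrite ?subrK.
rewrite -(h1 W n1) -(h2 W n2) -(h3 _ n3).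
have -> : Q - (W - P) = P + Q - W by rewrite opprB addrA [Q + P]addrC.
have -> : phi (P - W) = - phi (W - P) by rewrite -opprB phiN.
by rewrite [RHS]addrA subrK.
Qed.

End Isogeny.

(** * The endomorphism is an algebraic map *)

Section Forms.
Variable K : numClosedFieldType.
Implicit Types (P Q : E2 K) (F G : E2 K -> K) (p : {poly K}) (d k : nat).

(** Only the values of a homogeneous polynomial on the curve matter below, and
    the equation of the curve is used freely to simplify them. *)
Definition form d F := exists2 G : mpoly 3 K,
  G \is ishomog1 d mdeg & forall P, meval (E2_proj P) G = F P.

Lemma formM d e F G : form d F -> form e G -> form (d + e) (fun P => F P * G P).
Proof.
move=> [f hf ef] [g hg eg]; exists (f * g); first exact: dhomogM.
by move=> P; rewrite mevalM ef eg.
Qed.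

Lemma formD d F G : form d F -> form d G -> form d (fun P => F P + G P).
Proof.
move=> [f hf ef] [g hg eg]; exists (f + g); first exact: dhomogD.
by move=> P; rewrite mevalD ef eg.
Qed.

Lemma formZ d (a : K) F : form d F -> form d (fun P => a * F P).
Proof.
move=> [f hf ef]; exists (a *: f); first exact: dhomogZ.
by move=> P; rewrite mevalZ ef.
Qed.

Lemma form0 d : form d (fun=> 0).
Proof. by exists 0; [apply: dhomog0 | move=> P; rewrite meval0]. Qed.

Lemma formX d F n : form d F -> form (d * n) (fun P => F P ^+ n).
Proof.
move=> [f hf ef]; exists (f ^+ n); first exact: dhomogMn.
by move=> P; rewrite rmorphXn /= ef.
Qed.

Lemma form_sum d n (F : nat -> E2 K -> K) :
  (forall j, j < n -> form d (F j))%N -> form d (fun P => \sum_(j < n) F j P).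
Proof.
elim: n => [|n IH] h.
  by have [f hf ef] := form0 d; exists f => // P; rewrite big_ord0.
have [f hf ef] := formD (IH (fun j hj => h j (ltnW hj))) (h n (ltnSn n)).
by exists f => // P; rewrite big_ord_recr /=.
Qed.

Lemma form_coord (i : 'I_3) : form 1 (fun P => E2_proj P i).
Proof.
exists (mpolyX K (mnm1 i)); first by rewrite dhomogX /= mdeg1.
by move=> P; rewrite mevalXU.
Qed.

Definition hx P := E2_proj P (@Ordinal 3 0 isT).
Definition hy P := E2_proj P (@Ordinal 3 1 isT).
Definition hz P := E2_proj P (@Ordinal 3 2 isT).

Lemma hxyz_affine P : P != 0 -> [/\ hx P = xc P, hy P = yc P & hz P = 1].
Proof. by move=> /val_affine e; rewrite /hx /hy /hz /E2_proj e. Qed.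

Lemma hxyz0 : [/\ hx 0 = 0, hy 0 = 1 & hz 0 = 0].
Proof. by []. Qed.

(** On the curve [x^3 = z (y^2 + z^2)], so that the homogenisation of a
    polynomial in [x^3] is divisible by a power of [z]; without this power it
    does not vanish at infinity. *)
Lemma form_cube p k : (size p <= k.+1)%N -> exists F,
  [/\ form (2 * k) F, forall P, P != 0 -> F P = p.[xc P ^+ 3] & F 0 = p`_k].
Proof.
move=> sp.
pose T j P := p`_j * ((hy P ^+ 2 + hz P ^+ 2) ^+ j * (hz P ^+ 2) ^+ (k - j)).
pose F P := \sum_(j < k.+1) T j P.
exists F; split.
- apply: (form_sum (F := T)) => j jk; apply: formZ.
  rewrite -(subnKC (jk : (j <= k)%N)) mulnDr addKn.
  have fz : form 2 (fun P => hz P ^+ 2) by apply: (formX 2 (form_coord _)).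
  have fy : form 2 (fun P => hy P ^+ 2) by apply: (formX 2 (form_coord _)).
  exact: formM (formX j (formD fy fz)) (formX (k - j) fz).
- move=> P P0; rewrite /F /T; have [_ -> ->] := hxyz_affine P0.
  rewrite (horner_coef_wide _ sp); apply: eq_bigr => j _.
  by rewrite !expr1n mulr1 curveE // subrK.
rewrite /F /T; have [_ -> ->] := hxyz0; rewrite big_ord_recr /= big1 ?add0r.
  by rewrite subnn expr0n addr0 expr1n expr1n !mulr1.
by move=> j _; rewrite (expr0n _ 2) /= expr0n subn_eq0 leqNgt ltn_ord !mulr0.
Qed.

Lemma forms_algebraic (phi : E2 K -> E2 K) :
  (forall P, exists d F0 F1 F2,
    [/\ form d F0, form d F1, form d F2,
      [|| F0 P != 0, F1 P != 0 | F2 P != 0] &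
      forall Q, [|| F0 Q != 0, F1 Q != 0 | F2 Q != 0] -> exists2 a, a != 0 &
        [/\ F0 Q = a * hx (phi Q), F1 Q = a * hy (phi Q) & F2 Q = a * hz (phi Q)]]) ->
  E2_algebraic_map phi.
Proof.
move=> h P; have [d [F0 [F1 [F2 [[f0 h0 e0] [f1 h1 e1] [f2 h2 e2] nz hQ]]]]] := h P.
exists d, (fun i => nth 0 [:: f0; f1; f2] i); split.
- by case=> [[|[|[|]]]].
- case/or3P: nz => nz.
  + by exists (@Ordinal 3 0 isT); rewrite e0.
  + by exists (@Ordinal 3 1 isT); rewrite e1.
  + by exists (@Ordinal 3 2 isT); rewrite e2.
move=> Q [i hi]; have [|a a0 [g0 g1 g2]] := hQ Q.
  rewrite -e0 -e1 -e2; case: i hi => [[|[|[|//]]]] /= _ ->; by rewrite ?orbT.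
exists a => //; case=> [[|[|[|//]]]] /= hi'.
- by rewrite e0 g0; congr (_ * E2_proj _ _); apply: val_inj.
- by rewrite e1 g1; congr (_ * E2_proj _ _); apply: val_inj.
- by rewrite e2 g2; congr (_ * E2_proj _ _); apply: val_inj.
Qed.
End Forms.

Section LocalPowers.
Variable K : numClosedFieldType.
Implicit Types (U V : {poly K}).

Lemma expXsub_inj (r : K) m n U V : U.[r] != 0 -> V.[r] != 0 ->
  ('X - r%:P) ^+ m * U = ('X - r%:P) ^+ n * V -> m = n.
Proof.
wlog le_mn : m n U V / (m <= n)%N.
  move=> h U0 V0 e; case: (leqP m n) => [|/ltnW] le; first exact: h U0 V0 e.
  by apply/esym/(h _ _ _ _ le V0 U0).
move=> U0 V0; rewrite -(subnKC le_mn) exprD -mulrA.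
have l0 : ('X - r%:P) ^+ m != 0 by rewrite expf_neq0 // polyXsubC_eq0.
move/(mulfI l0) => e; move: U0; rewrite e.
case: (n - m)%N => [|k]; first by rewrite addn0.
by rewrite exprS !hornerM hornerXsubC subrr !mul0r eqxx.
Qed.

Lemma sizeM_top U V m n : (size U <= m.+1)%N -> (size V <= n.+1)%N ->
  (size (U * V)%R <= (m + n).+1)%N.
Proof.
move=> h1 h2; apply: leq_trans (size_polyMleq _ _) _.
by rewrite -subn1 leq_subLR (leq_trans (leq_add h1 h2)) // addSn addnS.
Qed.

Lemma coefM_top U V m n : (size U <= m.+1)%N -> (size V <= n.+1)%N ->
  (U * V)`_(m + n) = U`_m * V`_n.
Proof.
move=> sU sV; rewrite coefM.
have lm : (m < (m + n).+1)%N by rewrite ltnS leq_addr.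
rewrite (bigD1 (Ordinal lm)) //= addKn big1 ?addr0 // => j.
rewrite -(inj_eq val_inj) /= => jm.
have [lt|lt|e] := ltngtP j m; last by rewrite e eqxx in jm.
  rewrite [V`__]nth_default ?mulr0 //; apply: leq_trans sV _.
  by rewrite ltn_subRL ltn_add2r.
by rewrite nth_default ?mul0r // (leq_trans sU).
Qed.
End LocalPowers.

Section Algebraic.
Variable K : numClosedFieldType.
Variables (N D B : {poly K}) (c : K).
Hypotheses (copND : coprimep N D) (D0 : D != 0) (c0 : c != 0).
Hypothesis sizeN : size N = size D.
Hypothesis defB : B = N * D + 3 *: 'X * (N^`() * D - N * D^`()).
Hypothesis ode : c ^+ 2 *: (B ^+ 2 * ('X - 1)) = D * ('X * N ^+ 3 - D ^+ 3).
Implicit Types (P Q : E2 K).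

(** The leading terms of [N' D] and [N D'] cancel. *)
Lemma size_B k : size D = k.+1 -> (size B <= (2 * k).+1)%N /\ B`_(2 * k) != 0.
Proof.
move=> sD; have sN := sizeN; rewrite sD in sN.
have sX (U : {poly K}) : (size U <= k.+1)%N -> (size ('X * U^`())%R <= k.+1)%N.
  move=> h; rewrite mulrC; case: (eqVneq U^`() 0) => [->|U0]; first by rewrite mul0r size_poly0.
  by rewrite size_mulX // (leq_trans (lt_size_deriv _)) //; apply: contraNneq U0 => ->; rewrite linear0.
have cX (U : {poly K}) j : ('X * U^`())`_j = j%:R * U`_j.
  by rewrite coefXM; case: j => [|j]; rewrite ?mul0r //= coef_deriv mulr_natl.
have eB : B = N * D + 3 *: (('X * N^`()) * D - N * ('X * D^`())).
  by rewrite defB -!mul_polyC; ring.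
have sNl : (size N <= k.+1)%N by rewrite sN.
have sDl : (size D <= k.+1)%N by rewrite sD.
have sM (U V : {poly K}) : (size U <= k.+1)%N -> (size V <= k.+1)%N -> (size (U * V)%R <= (2 * k).+1)%N.
  by rewrite mul2n -addnn; apply: sizeM_top.
split.
  rewrite eB; apply: leq_trans (size_polyD _ _) _; rewrite geq_max sM //=.
  apply: leq_trans (size_scale_leq _ _) _; apply: leq_trans (size_polyD _ _) _.
  by rewrite size_polyN geq_max !sM // sX.
rewrite eB coefD coefZ coefB mul2n -addnn !coefM_top ?sX // !cX.
rewrite -mulrA mulrCA subrr mulr0 addr0.
have lN : N`_k = lead_coef N by rewrite /lead_coef sN.
have lD : D`_k = lead_coef D by rewrite /lead_coef sD.
by rewrite lN lD mulf_neq0 // lead_coef_eq0 // -size_poly_eq0 sN.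
Qed.

(** Comparing orders at [r] on both sides of [ode]: if [D] has order [n], then
    [B] has order [n] at [r = 0] and [n - 1] elsewhere, so [2 n = n + 1],
    [2 (n - 1) + 1 = n] or [2 (n - 1) = n]. *)
Lemma pole_orders r : D.[r] = 0 ->
  [\/ r = 0 /\ (exists D1 B1, [/\ D = 'X * D1, B = 'X * B1 & B1.[0] != 0]),
      r = 1 /\ (exists2 D1, D = ('X - 1) * D1 & B.[1] != 0) |
      [/\ r != 0, r != 1 & exists D1 B1, [/\ D = ('X - r%:P) ^+ 2 * D1,
        B = ('X - r%:P) * B1 & B1.[r] != 0]]].
Proof.
move=> Dr; have [k [D1 hD1 eD]] := multiplicity_XsubC D r.
rewrite D0 /= /root in hD1; rewrite mulrC in eD.
have Nr : N.[r] != 0 by apply: (@coprimep_root _ D N); rewrite 1?coprimep_sym //; apply/eqP.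
case: k eD => [|k] eD.
  by move: hD1; rewrite -[D1]mul1r -(expr0 ('X - r%:P)) -eD Dr eqxx.
have [l el] : exists l : {poly K}, l = 'X - r%:P by exists ('X - r%:P).
have linj m n U V := @expXsub_inj K r m n U V; rewrite -el in eD linj.
have l0 : l.[r] = 0 by rewrite el hornerXsubC subrr.
have dD : D^`() = l ^+ k * (k.+1%:R *: D1 + l * D1^`()).
  rewrite eD derivM deriv_exp el derivXsubC mul1r /= exprS -scaler_nat -!mul_polyC; ring.
have h3 n : (n.+1%:R : K) != 0 by rewrite pnatr_eq0.
case: (eqVneq r 0) => [r0|r0].
  pose M := N * D1 + 3 *: (N^`() * l * D1 - N * (k.+1%:R *: D1 + l * D1^`())).
  have eB : B = l ^+ k.+1 * M.
    rewrite defB dD eD /M -!mul_polyC exprS (_ : 'X = l); last by rewrite el r0 subr0.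
    ring.
  have Mr : M.[r] != 0.
    have -> : M.[r] = - (N.[r] * D1.[r] * (3 * k).+2%:R).
      rewrite /M; push_eval; rewrite l0 -[(3 * k).+2%:R]natr1 -[(3 * k).+1%:R]natr1 natrM -[k.+1%:R]natr1; ring.
    by rewrite oppr_eq0 !mulf_neq0.
  clearbody M; have e := ode; rewrite eB {1 2}eD in e.
  have e2 : l ^+ (2 * k.+1) * (c ^+ 2 *: (M ^+ 2 * ('X - 1))) =
     l ^+ k.+2 * (D1 * (N ^+ 3 - l ^+ (3 * k).+2 * D1 ^+ 3)).
    transitivity (c ^+ 2 *: ((l ^+ k.+1 * M) ^+ 2 * ('X - 1))).
      by rewrite mulnC exprM -!mul_polyC; ring.
    rewrite e (_ : 'X = l); last by rewrite el r0 subr0.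
    by rewrite !exprS mulnC exprM; ring.
  have := linj _ _ _ _ _ _ e2; rewrite mul2n -addnn addSn => h.
  have {}h : ((k + k.+1).+1 = k.+2)%N.
    apply: h; push_eval.
      by rewrite !mulf_neq0 ?expf_neq0 // subr_eq0 r0 eq_sym oner_eq0.
    by rewrite l0 (expr0n _ (3 * k).+2) /= mul0r subr0 mulf_neq0 ?expf_neq0.
  have k0 : k = 0%N by move: h => /eqP; rewrite addnS !eqSS -[X in _ == X]add0n eqn_add2r => /eqP.
  apply: Or31; split=> //; exists D1, M; rewrite k0 !expr1 in eD eB.
  have lX : l = 'X by rewrite el r0 subr0.
  by rewrite lX in eD eB; rewrite r0 in Mr; split.
pose M := l * N * D1 + 3 *: ('X * (N^`() * l * D1 - N * (k.+1%:R *: D1 + l * D1^`()))).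
have eB : B = l ^+ k * M.
  by rewrite defB dD eD /M -!mul_polyC exprS; ring.
have Mr : M.[r] != 0.
  have -> : M.[r] = - (3 * r * N.[r] * D1.[r] * k.+1%:R).
    by rewrite /M; push_eval; rewrite l0; ring.
  by rewrite oppr_eq0 !mulf_neq0.
clearbody M; have e := ode; rewrite eB {1}eD in e.
have Vr : (D1 * ('X * N ^+ 3 - D ^+ 3)).[r] != 0.
  by push_eval; rewrite Dr expr0n subr0 !mulf_neq0 ?expf_neq0.
case: (eqVneq r 1) => [r1|r1].
  have e2 : l ^+ (2 * k).+1 * (c ^+ 2 *: M ^+ 2) = l ^+ k.+1 * (D1 * ('X * N ^+ 3 - D ^+ 3)).
    rewrite mulrA -e (_ : 'X - 1 = l); last by rewrite el r1.
    by rewrite exprS mulnC exprM -!mul_polyC; ring.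
  have {}e2 : ((2 * k).+1 = k.+1)%N.
    apply: (linj _ _ _ _ _ Vr e2); push_eval; by rewrite mulf_neq0 ?expf_neq0.
  have k0 : k = 0%N by move/eqP: e2; rewrite mul2n -addnn eqSS -[X in _ == X]add0n eqn_add2r => /eqP.
  apply: Or32; split=> //; rewrite k0 expr1 expr0 mul1r in eD eB; exists D1; last by rewrite eB -r1.
  by rewrite {1}eD el r1.
have e2 : l ^+ (2 * k) * (c ^+ 2 *: (M ^+ 2 * ('X - 1))) = l ^+ k.+1 * (D1 * ('X * N ^+ 3 - D ^+ 3)).
  by rewrite mulrA -e mulnC exprM -!mul_polyC; ring.
have {}e2 : (2 * k = k.+1)%N.
  by apply: (linj _ _ _ _ _ Vr e2); push_eval; rewrite !mulf_neq0 ?expf_neq0 // subr_eq0.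
have k1 : k = 1%N by move/eqP: e2; rewrite mul2n -addnn -addn1 eqn_add2l => /eqP.
rewrite k1 ?expr1 in eD eB.
by apply: Or33; split=> //; exists D1, M; rewrite -el; split.
Qed.

Local Notation phiND := (phi N D B c).

(** Triples [(x a, y b, e)] of functions of [x^3] proportional to the triple
    [(x N D, c y B, D^2)], which represents [phi N D B c] away from its poles. *)
Lemma even_chart P (a b e h : {poly K}) k :
  (size a <= k.+1)%N -> (size b <= k.+1)%N -> (size e <= k.+1)%N ->
  h * a = N * D -> h * b = c *: B -> h * e = D ^+ 2 ->
  (forall Q, Q != 0 -> D.[xc Q ^+ 3] = 0 ->
     xc Q * a.[xc Q ^+ 3] = 0 /\ e.[xc Q ^+ 3] = 0) ->
  (if P == 0 then b`_k != 0 else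
     (yc P * b.[xc P ^+ 3] != 0) || (e.[xc P ^+ 3] != 0)) ->
  exists d F0 F1 F2,
    [/\ form d F0, form d F1, form d F2,
      [|| F0 P != 0, F1 P != 0 | F2 P != 0] &
      forall Q, [|| F0 Q != 0, F1 Q != 0 | F2 Q != 0] -> exists2 t, t != 0 &
        [/\ F0 Q = t * hx (phiND Q), F1 Q = t * hy (phiND Q) & F2 Q = t * hz (phiND Q)]].
Proof.
move=> sa sb se ha hb he hpole nz.
have [Fa [fa ea ia]] := form_cube sa; have [Fb [fb eb ib]] := form_cube sb.
have [Fe [fe ee ie]] := form_cube se.
exists (1 + 2 * k)%N, (fun Q => hx Q * Fa Q), (fun Q => hy Q * Fb Q), (fun Q => hz Q * Fe Q).
have [h0x h0y h0z] := hxyz0 K.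
split; try by apply: formM => //; apply: form_coord.
  move: nz; case: eqP => [->|/eqP P0].
    by rewrite h0y mul1r ib => ->; rewrite orbT.
  have [-> -> ->] := hxyz_affine P0; rewrite mul1r ea // eb // ee //.
  by case/orP => ->; rewrite ?orbT.
move=> Q; case: (eqVneq Q 0) => [->|Q0].
  rewrite phi0 h0x h0y h0z !mul0r eqxx mul1r /= orbF => Fb0.
  by exists (Fb 0); rewrite ?mulr0 ?mulr1.
have [-> -> ->] := hxyz_affine Q0; rewrite mul1r ea // eb // ee //.
case: (eqVneq D.[xc Q ^+ 3] 0) => d.
  have [-> ->] := hpole Q Q0 d; rewrite eqxx /= orbF => nb.
  exists (yc Q * b.[xc Q ^+ 3]) => //.
  by rewrite phi_pole // h0x h0y h0z !mulr0 mulr1.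
move=> _; have [F0 ex ey] := phi_affine ode Q0 d.
have [-> -> ->] := hxyz_affine F0; rewrite ex ey /phi_x /phi_y.
have := congr1 (horner^~ (xc Q ^+ 3)) ha; have := congr1 (horner^~ (xc Q ^+ 3)) hb.
have := congr1 (horner^~ (xc Q ^+ 3)) he; push_eval => ke kb ka.
have hn : h.[xc Q ^+ 3] != 0.
  by apply: contraNneq d => h0; move: ke; rewrite h0 mul0r => /esym/eqP; rewrite expf_eq0.
exists (D.[xc Q ^+ 3] ^+ 2 / h.[xc Q ^+ 3]); first by rewrite mulf_neq0 ?invr_eq0 ?expf_neq0.
split; apply: (mulfI hn).
- rewrite mulrCA ka; by field; rewrite hn d.
- rewrite mulrCA kb; by field; rewrite hn d.
- rewrite ke; by field.
Qed.

(** At the poles with [y = 0] all three functions of the triple above vanish;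
    it is multiplied by [y] and divided by [x^3 - 1 = y^2]. *)
Lemma odd_chart P D1 : D = ('X - 1) * D1 -> B.[1] != 0 -> P != 0 -> xc P ^+ 3 = 1 ->
  exists d F0 F1 F2,
    [/\ form d F0, form d F1, form d F2,
      [|| F0 P != 0, F1 P != 0 | F2 P != 0] &
      forall Q, [|| F0 Q != 0, F1 Q != 0 | F2 Q != 0] -> exists2 t, t != 0 &
        [/\ F0 Q = t * hx (phiND Q), F1 Q = t * hy (phiND Q) & F2 Q = t * hz (phiND Q)]].
Proof.
move=> eD B1 P0 xP.
pose k := (size (N * D1)%R + size B + size (D * D1)%R)%N.
have sa : (size (N * D1)%R <= k.+1)%N by rewrite leqW // /k -addnA leq_addr.
have sb : (size B <= k.+1)%N by rewrite leqW // /k addnAC leq_addl.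
have se : (size (D * D1)%R <= k.+1)%N by rewrite leqW // /k leq_addl.
have [Fa [fa ea ia]] := form_cube sa; have [Fb [fb eb ib]] := form_cube sb.
have [Fe [fe ee ie]] := form_cube se.
exists (1 + 1 + 2 * k)%N, (fun Q => hx Q * hy Q * Fa Q),
  (fun Q => hz Q * hz Q * (c * Fb Q)), (fun Q => hy Q * hz Q * Fe Q).
have [h0x h0y h0z] := hxyz0 K.
split; try by apply: formM; [apply: formM; apply: form_coord|]; try apply: formZ.
  have [-> -> ->] := hxyz_affine P0; apply/or3P/Or32.
  by rewrite eb // xP !mul1r mulf_neq0.
move=> Q; case: (eqVneq Q 0) => [->|Q0].
  by rewrite h0x h0y h0z !mul0r !mulr0 mul0r eqxx.
have [-> -> ->] := hxyz_affine Q0; rewrite !mul1r mulr1 ea // eb // ee //.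
have e := curveE Q0; have := congr1 (horner^~ (xc Q ^+ 3)) eD; push_eval; rewrite -e => dQ.
case: (eqVneq D.[xc Q ^+ 3] 0) => d.
  have yD : yc Q * D1.[xc Q ^+ 3] = 0.
    move: d; rewrite dQ => /eqP; rewrite mulf_eq0 expf_eq0 /=.
    by case/orP => /eqP->; rewrite ?mul0r ?mulr0.
  rewrite d mul0r mulr0 (_ : xc Q * _ * _ = 0); last first.
    by transitivity (xc Q * N.[xc Q ^+ 3] * (yc Q * D1.[xc Q ^+ 3])); [ring | rewrite yD mulr0].
  rewrite eqxx /= orbF => nb; exists (c * B.[xc Q ^+ 3]) => //.
  by rewrite phi_pole // h0x h0y h0z !mulr0 mulr1.
move=> _; have [F0 ex ey] := phi_affine ode Q0 d.
have := d; rewrite dQ mulf_eq0 expf_eq0 negb_or /= => /andP[y0 d1].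
have [-> -> ->] := hxyz_affine F0; rewrite ex ey /phi_x /phi_y dQ.
exists (yc Q ^+ 3 * D1.[xc Q ^+ 3] ^+ 2); first by rewrite mulf_neq0 ?expf_neq0.
by split; field; rewrite ?y0 ?d1.
Qed.

(** By [pole_orders], a common factor of [x N D], [B] and [D^2] is removed at each
    kind of pole, after which the second function does not vanish there. *)
Theorem phi_algebraic : E2_algebraic_map phiND.
Proof.
apply: forms_algebraic => P.
pose big (a b e : {poly K}) := (size a + size b + size e)%N.
have sz (a b e : {poly K}) : [/\ size a <= (big a b e).+1,
    size b <= (big a b e).+1 & size e <= (big a b e).+1]%N.
  split; rewrite leqW // /big; first by rewrite -addnA leq_addr.
    by rewrite addnAC leq_addl.
  by rewrite leq_addl.
have hpole Q : Q != 0 -> D.[xc Q ^+ 3] = 0 ->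
    xc Q * (N * D).[xc Q ^+ 3] = 0 /\ (D ^+ 2).[xc Q ^+ 3] = 0.
  by move=> _ d; push_eval; rewrite d expr0n !mulr0.
case: (eqVneq P 0) => [P0|P0].
  case sD: (size D) (size_poly_eq0 D) => [|k] h; first by move: D0; rewrite -h eqxx.
  have sN : (size N <= k.+1)%N by rewrite sizeN sD.
  have sD' : (size D <= k.+1)%N by rewrite sD.
  have [sB lB] := size_B sD.
  apply: (@even_chart P (N * D) (c *: B) (D ^+ 2) 1 (2 * k)); rewrite ?mul1r //.
  - by rewrite mul2n -addnn sizeM_top.
  - exact: leq_trans (size_scale_leq _ _) sB.
  - by rewrite mul2n -addnn expr2 sizeM_top.
  - by rewrite P0 eqxx coefZ mulf_neq0.
case: (eqVneq D.[xc P ^+ 3] 0) => d; last first.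
  have [s1 s2 s3] := sz (N * D) (c *: B) (D ^+ 2).
  apply: (@even_chart P (N * D) (c *: B) (D ^+ 2) 1 _ s1 s2 s3); rewrite ?mul1r //.
  by rewrite (negbTE P0); push_eval; rewrite expf_neq0 ?orbT.
have e := curveE P0.
case: (pole_orders d) => [[s0 [D1 [B1 [eD eB B10]]]]|[s1 [D1 eD B1]]|[s0 s1 [D1 [B1 [eD eB B10]]]]].
- have [s1 s2 s3] := sz (N * D1) (c *: B1) ('X * D1 ^+ 2).
  apply: (@even_chart P _ _ _ 'X _ s1 s2 s3); rewrite ?eD ?eB //.
  + by ring.
  + by rewrite -!mul_polyC; ring.
  + by ring.
  + move=> Q Q0; push_eval => /eqP; rewrite mulf_eq0 expf_eq0 /= => /orP[] /eqP ->.
      by rewrite expr0n !mul0r.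
    by rewrite expr0n /= !mulr0.
  rewrite (negbTE P0) s0; push_eval; apply/orP; left; rewrite !mulf_neq0 //.
  apply: contraTneq isT => y0; move: e; rewrite s0 y0 expr0n sub0r => /eqP.
  by rewrite eq_sym oppr_eq0 oner_eq0.
- exact: odd_chart eD B1 P0 s1.
set r := xc P ^+ 3 in s0 s1 eD eB B10; pose l := 'X - r%:P.
have [q1 q2 q3] := sz (N * (l * D1)) (c *: B1) (l ^+ 3 * D1 ^+ 2).
apply: (@even_chart P _ _ _ l _ q1 q2 q3); rewrite ?eD ?eB -/l //.
- by ring.
- by rewrite -!mul_polyC; ring.
- by ring.
- move=> Q Q0; rewrite !(horner_exp, hornerM) => /eqP.
  rewrite mulf_eq0 expf_eq0 /= => /orP[] /eqP ->.
    by rewrite expr0n /= !(mul0r, mulr0).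
  by rewrite expr0n /= !(mul0r, mulr0).
rewrite (negbTE P0) -/r; push_eval; apply/orP; left; rewrite !mulf_neq0 //.
by apply: contra s1 => /eqP y0; rewrite -subr_eq0 /r -e y0 expr0n.
Qed.
End Algebraic.

(** * Truncated power series *)

Section Truncation.
Variable K : numFieldType.
Implicit Types (p q r : {poly K}) (n : nat).

Definition eqmodX n p q := 'X^n %| p - q.

Lemma dvdXnP n p : reflect (forall i, (i < n)%N -> p`_i = 0) ('X^n %| p).
Proof.
apply: (iffP idP) => [/dvdpP[q ->] i lt_in|h]; first by rewrite coefMXn lt_in.
rewrite -(poly_take_drop n p) dvdp_addr ?dvdp_mull //.
suff -> : take_poly n p = 0 by apply: dvdp0.
by apply/polyP => i; rewrite coef_take_poly coef0; case: ltnP => // /h.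
Qed.

Lemma eqmodX_refl n p : eqmodX n p p.
Proof. by rewrite /eqmodX subrr dvdp0. Qed.

Lemma eqmodX_sym n p q : eqmodX n p q -> eqmodX n q p.
Proof. by rewrite /eqmodX -opprB dvdpNr. Qed.

Lemma eqmodX_trans n q p r : eqmodX n p q -> eqmodX n q r -> eqmodX n p r.
Proof. by move=> h1 h2; have := dvdp_add h1 h2; rewrite addrA subrK. Qed.

Lemma eqmodXD n p p' q q' :
  eqmodX n p p' -> eqmodX n q q' -> eqmodX n (p + q) (p' + q').
Proof.
move=> h1 h2; have := dvdp_add h1 h2.
by rewrite /eqmodX (_ : p - p' + _ = p + q - (p' + q')) //; ring.
Qed.

Lemma eqmodXM n p p' q q' :
  eqmodX n p p' -> eqmodX n q q' -> eqmodX n (p * q) (p' * q').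
Proof.
move=> h1 h2; rewrite /eqmodX.
rewrite (_ : p * q - _ = (p - p') * q + p' * (q - q')); last by ring.
by apply: dvdp_add; [apply: dvdp_mulr | apply: dvdp_mull].
Qed.

Lemma eqmodXMl n r p q : eqmodX n p q -> eqmodX n (r * p) (r * q).
Proof. by move=> h; apply: eqmodXM (eqmodX_refl _ _) h. Qed.

Lemma eqmodXMr n r p q : eqmodX n p q -> eqmodX n (p * r) (q * r).
Proof. by move=> h; apply: eqmodXM h (eqmodX_refl _ _). Qed.

Lemma eqmodXX n p q m : eqmodX n p q -> eqmodX n (p ^+ m) (q ^+ m).
Proof.
move=> h; elim: m => [|m IH]; first exact: eqmodX_refl.
by rewrite !exprS; apply: eqmodXM.
Qed.

Lemma eqmodXB n p p' q q' :
  eqmodX n p p' -> eqmodX n q q' -> eqmodX n (p - q) (p' - q').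
Proof.
move=> h1 h2; have := dvdp_sub h1 h2.
by rewrite /eqmodX (_ : p - p' - _ = p - q - (p' - q')) //; ring.
Qed.

Lemma eqmodXW m n p q : (n <= m)%N -> eqmodX m p q -> eqmodX n p q.
Proof. by move=> h; apply: dvdp_trans; rewrite dvdp_exp2l. Qed.

Lemma eqmodX_deriv n p q : eqmodX n.+1 p q -> eqmodX n p^`() q^`().
Proof.
move=> /dvdXnP h; rewrite /eqmodX -derivB; apply/dvdXnP => i lt_in.
by rewrite coef_deriv h ?mul0rn.
Qed.

Lemma eqmodX_integrate n p q :
  p.[0] = q.[0] -> eqmodX n p^`() q^`() -> eqmodX n.+1 p q.
Proof.
move=> e0 /dvdXnP h; apply/dvdXnP => -[|i] lt_in.
  by rewrite -horner_coef0 hornerD hornerN e0 subrr.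
have := h i lt_in; rewrite -derivB coef_deriv => /eqP.
by rewrite mulrn_eq0 => /eqP.
Qed.

Lemma eqmodX_cancel n r p q : r.[0] != 0 ->
  eqmodX n (r * p) (r * q) -> eqmodX n p q.
Proof.
move=> r0; rewrite /eqmodX -mulrBr Gauss_dvdpr //.
rewrite coprimep_expl // coprimep_sym -['X]subr0 -[X in 'X - X]/(0%:P).
by rewrite coprimep_XsubC.
Qed.

Lemma eqmodX_comp n w p q : w.[0] = 0 -> eqmodX n p q ->
  eqmodX n (p \Po w) (q \Po w).
Proof.
move=> w0 /dvdpP[r e]; rewrite /eqmodX -comp_polyB e comp_polyM comp_Xn_poly.
apply: dvdp_mull; apply: dvdp_exp2r.
by rewrite -['X]subr0 -[X in 'X - X]/(0%:P) dvdp_XsubCl /root w0.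
Qed.

Lemma eqmodX_eq p q : (forall n, eqmodX n p q) -> p = q.
Proof.
move=> h; apply/eqP; rewrite -subr_eq0; apply: contraT => nz.
have := dvdp_leq nz (h (size (p - q))).
by rewrite size_polyXn ltnn.
Qed.

Lemma eqmodX_inv n p : p.[0] != 0 -> exists q, eqmodX n (p * q) 1.
Proof.
move=> p0; have : coprimep 'X^n p.
  rewrite coprimep_expl // coprimep_sym -['X]subr0 -[X in 'X - X]/(0%:P).
  by rewrite coprimep_XsubC.
case/Bezout_eq1_coprimepP => -[u v] /= e; exists v.
rewrite /eqmodX -e (_ : _ - _ = - u * 'X^n); last by ring.
by rewrite dvdp_mull.
Qed.

End Truncation.

(** ** The hypergeometric series *)

Section Series.
Variable K : numFieldType.

(** The Taylor coefficients of [(1 - X)^(-1/2)]. *)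
Definition binom_coef (n : nat) : K := rising (1 / 2) n / n`!%:R.

Lemma binom_coefS n :
  n.+1%:R * binom_coef n.+1 = (n%:R + 1 / 2) * binom_coef n.
Proof.
rewrite /binom_coef /rising big_ord_recr /= factS natrM.
have n0 : (n.+1%:R : K) != 0 by rewrite pnatr_eq0.
have f0 : (n`!%:R : K) != 0 by rewrite pnatr_eq0 -lt0n fact_gt0.
by field; rewrite f0 -[1]/(1%:R) -natrD pnatr_eq0.
Qed.

Lemma hyp2F1_coefE n :
  hyp2F1_coef (1 / 2) (1 / 6) (7 / 6) n = binom_coef n / (6 * n + 1)%:R :> K.
Proof.
have d0 m : ((6 * m + 1)%:R : K) != 0 by rewrite pnatr_eq0 addn1.
have f0 m : (m`!%:R : K) != 0 by rewrite pnatr_eq0 -lt0n fact_gt0.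
have r7 m : rising (7 / 6 : K) m != 0.
  rewrite /rising; elim: m => [|m IH]; first by rewrite big_ord0 oner_neq0.
  rewrite big_ord_recr /= mulf_neq0 // gt_eqF // ltr_wpDr ?ler0n //.
  by rewrite divr_gt0 ?ltr0n.
have e m : rising (1 / 6 : K) m * (6 * m + 1)%:R = rising (7 / 6) m.
  elim: m => [|m IH]; first by rewrite /rising !big_ord0 muln0 mul1r.
  rewrite /rising !big_ord_recr /= -/(rising _ m) -/(rising _ m) -IH.
  by rewrite !natrD !natrM -[m.+1%:R]natr1; field.
rewrite /hyp2F1_coef /binom_coef -e.
have := r7 n; rewrite -e mulf_eq0 negb_or.
move: (6 * n + 1)%:R => d /andP[h1 h2].
by field; rewrite h1 h2 f0.
Qed.

Lemma binom_coef_bounds n : 0 <= binom_coef n <= 1.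
Proof.
elim: n => [|n /andP[h0 h1]].
  by rewrite /binom_coef /rising big_ord0 fact0 divr1 ler01 lexx.
have n0 : (0 : K) < n.+1%:R by rewrite ltr0n.
have h2 : (0 : K) <= 1 / 2 by rewrite divr_ge0.
have h3 : (1 / 2 : K) <= 1 by rewrite ler_pdivrMr // mul1r ler1n.
apply/andP; split.
  by rewrite -(pmulr_rge0 _ n0) binom_coefS mulr_ge0 // addr_ge0.
rewrite -(ler_pM2l n0) binom_coefS mulr1 -[n.+1%:R]natr1.
by apply: (le_trans (ler_piMr _ h1)); rewrite ?addr_ge0 // lerD2l.
Qed.

Definition hyp_trunc n : {poly K} :=
  \poly_(k < n.+1) (hyp2F1_coef (1 / 2) (1 / 6) (7 / 6) k).
Definition binom_trunc n : {poly K} := \poly_(k < n.+1) binom_coef k.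

(** In analytic terms, [z^(1/6) F(z)] is an integral of a multiple of
    [z^(-5/6) (1 - z)^(-1/2)]. *)
Lemma hyp_trunc_ode n :
  6 * ('X * (hyp_trunc n)^`()) + hyp_trunc n = binom_trunc n.
Proof.
rewrite [6 * _]mulr_natl -scaler_nat.
apply/polyP => i; rewrite coefD coefZ coefXM coef_deriv !coef_poly.
case: i => [|i] /=.
  by rewrite mulr0 add0r hyp2F1_coefE muln0 divr1.
case: ifP => _; last by rewrite mul0rn mulr0 addr0.
have d0 : ((6 * i.+1 + 1)%:R : K) != 0 by rewrite pnatr_eq0 addn1.
rewrite hyp2F1_coefE; set t := _ / _.
transitivity ((6 * i.+1 + 1)%:R * t); last by rewrite /t mulrC divfK.
by rewrite -[t *+ _]mulr_natl natrD natrM; ring.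
Qed.

(** From the differential equation [2 (1 - X) H' = H]. *)
Lemma binom_trunc_sqr n : eqmodX n.+1 (binom_trunc n ^+ 2 * (1 - 'X)) 1.
Proof.
set H := binom_trunc n.
apply: eqmodX_integrate.
  rewrite hornerM horner_exp hornerD hornerN !hornerC hornerX subr0 mulr1.
  rewrite /H horner_coef0 coef_poly /= /binom_coef /rising big_ord0 fact0.
  by rewrite divr1 expr1n.
have -> : (1 : {poly K})^`() = 0 by rewrite derivC.
have -> : (H ^+ 2 * (1 - 'X))^`() = H * (2 *: H^`() - 2 *: ('X * H^`()) - H).
  rewrite derivM deriv_exp derivB derivC derivX -!mul_polyC /=; ring.
rewrite -[X in eqmodX _ _ X](mulr0 H); apply: eqmodXMl.
rewrite /eqmodX subr0; apply/dvdXnP => i lt_in.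
have lt_i1 : (i.+1 < n.+1)%N by [].
rewrite !coefB !coefZ coefXM !coef_deriv !coef_poly lt_i1 (ltnW lt_i1).
rewrite -[_ *+ i.+1]mulr_natl binom_coefS.
case: i lt_in lt_i1 => [|i] lt_in lt_i1 /=.
  by rewrite mulr0 subr0; field.
by rewrite (ltnW lt_i1) -[_ *+ i.+1]mulr_natl; field.
Qed.

End Series.

Section Formal.
Variable K : numFieldType.
Implicit Types (p q r w a b F H m : {poly K}) (n : nat).

Lemma eqmodX_at0 n p q : eqmodX n.+1 p q -> p.[0] = q.[0].
Proof.
move=> /dvdXnP/(_ 0%N isT); rewrite -horner_coef0 hornerD hornerN => /eqP.
by rewrite subr_eq0 => /eqP.
Qed.

(** Differentiating [F^2 r = m F(w)^2], where [w r^3 = X], and eliminating [F']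
    by [6 X F' + F = H] leaves an identity between [H] and [H(w)], which is
    algebraic since [H^2 = 1 / (1 - X)]. *)
Lemma formal_differentiation n F H r w m :
  6 * ('X * F^`()) + F = H -> eqmodX n.+1 (H ^+ 2 * (1 - 'X)) 1 ->
  F.[0] != 0 -> r.[0] != 0 -> w.[0] = 0 -> m^`() = 0 ->
  eqmodX n.+1 (w * r ^+ 3) 'X -> eqmodX n.+1 (F ^+ 2 * r) (m * (F \Po w) ^+ 2) ->
  eqmodX n (1 - w) (m * r ^+ 5 * w^`() ^+ 2 * (1 - 'X)).
Proof.
move=> eH hH F0 r0 w0 m' hw hF.
set Fw := F \Po w in hF *; set F'w := F^`() \Po w; set Hw := H \Po w.
have eHw : 6 * (w * F'w) + Fw = Hw.
  rewrite /Hw -eH comp_polyD comp_polyM comp_polyM comp_polyX.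
  by rewrite -[6]/(6%:R) -[6%:R \Po w]/((6%:R : {poly K}) \Po w) (rmorph_nat (comp_poly w)).
have hw' : eqmodX n (w^`() * r ^+ 3 + 3 * w * r ^+ 2 * r^`()) 1.
  have := eqmodX_deriv hw; rewrite !(deriv_exp, derivM) derivX /=.
  by rewrite (_ : w^`() * _ + _ = w^`() * r ^+ 3 + 3 * w * r ^+ 2 * r^`()) //; ring.
have {}hwn : eqmodX n (w * r ^+ 3) 'X by apply: eqmodXW hw.
have hrw : eqmodX n (r ^+ 4 * w^`()) (r - 3 * r^`() * 'X).
  have -> : r ^+ 4 * w^`() =
      r * (w^`() * r ^+ 3 + 3 * w * r ^+ 2 * r^`()) - 3 * r^`() * (w * r ^+ 3) by ring.
  by rewrite -[X in eqmodX _ _ (X - _)]mulr1; apply: eqmodXB; apply: eqmodXMl.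
have hF' : eqmodX n (2 * F * F^`() * r + F ^+ 2 * r^`()) (m * (2 * Fw * F'w * w^`())).
  have := eqmodX_deriv hF; rewrite !(deriv_exp, derivM) deriv_comp m' /=.
  rewrite (_ : _ + F ^+ 2 * _ = 2 * F * F^`() * r + F ^+ 2 * r^`()); last by ring.
  by rewrite (_ : 0 * _ + _ = m * (2 * Fw * F'w * w^`())) //; rewrite /F'w; ring.
have {}hFn : eqmodX n (F ^+ 2 * r) (m * Fw ^+ 2) by apply: eqmodXW hF.
have S1 : eqmodX n (F * r * H) (m * Fw * w^`() * r ^+ 3 * Hw).
  apply: (@eqmodX_cancel _ _ 2); first by rewrite -[2]/(2%:R) hornerMn hornerC pnatr_eq0.
  have -> : 2 * (F * r * H) = 6 * 'X * (2 * F * F^`() * r + F ^+ 2 * r^`())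
      + 2 * F ^+ 2 * (r - 3 * r^`() * 'X) by rewrite -eH; ring.
  have -> : 2 * (m * Fw * w^`() * r ^+ 3 * Hw) =
      12 * (m * Fw * F'w * w^`()) * (w * r ^+ 3) + 2 * (m * Fw ^+ 2) * (w^`() * r ^+ 3).
    by rewrite -eHw; ring.
  apply: eqmodXD.
    apply: eqmodX_trans (eqmodXMl _ hF') _; apply: eqmodX_sym.
    apply: eqmodX_trans (eqmodXMl _ hwn) _.
    by rewrite (_ : _ * 'X = 6 * 'X * (m * (2 * Fw * F'w * w^`()))) ?eqmodX_refl //; ring.
  apply: eqmodX_trans (eqmodXMl _ (eqmodX_sym hrw)) _.
  rewrite (_ : 2 * F ^+ 2 * _ = 2 * (F ^+ 2 * r) * (w^`() * r ^+ 3)); last by ring.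
  exact/eqmodXMr/eqmodXMl.
have S2 : eqmodX n (H ^+ 2) (m * r ^+ 5 * w^`() ^+ 2 * Hw ^+ 2).
  apply: (@eqmodX_cancel _ _ (F ^+ 2 * r ^+ 2)).
    by rewrite hornerM !horner_exp mulf_neq0 ?expf_neq0.
  rewrite (_ : F ^+ 2 * r ^+ 2 * H ^+ 2 = (F * r * H) ^+ 2); last by ring.
  apply: eqmodX_trans (eqmodXX 2 S1) _.
  rewrite (_ : (_ * Hw) ^+ 2 = m * Fw ^+ 2 * (m * w^`() ^+ 2 * r ^+ 6 * Hw ^+ 2)); last by ring.
  apply: eqmodX_trans (eqmodXMr _ (eqmodX_sym hFn)) _.
  rewrite (_ : F ^+ 2 * r * _ = F ^+ 2 * r ^+ 2 * (m * r ^+ 5 * w^`() ^+ 2 * Hw ^+ 2)).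
    exact: eqmodX_refl.
  by ring.
have hHn : eqmodX n (H ^+ 2 * (1 - 'X)) 1 by apply: eqmodXW hH.
have hHw : eqmodX n (Hw ^+ 2 * (1 - w)) 1.
  have := eqmodX_comp w0 hHn.
  by rewrite comp_polyM rmorphXn /= comp_polyB comp_polyX -[1]/(1%:P) !comp_polyC.
have := eqmodXMr ((1 - 'X) * (1 - w)) S2.
rewrite (_ : H ^+ 2 * _ = (1 - w) * (H ^+ 2 * (1 - 'X))); last by ring.
rewrite (_ : _ * Hw ^+ 2 * _ = m * r ^+ 5 * w^`() ^+ 2 * (1 - 'X) * (Hw ^+ 2 * (1 - w))); last by ring.
move=> h; have h1 := eqmodXMl (1 - w) (eqmodX_sym hHn).
have h2 := eqmodXMl (m * r ^+ 5 * w^`() ^+ 2 * (1 - 'X)) hHw.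
by have := eqmodX_trans (eqmodX_trans h1 h) h2; rewrite !mulr1.
Qed.

(** Multiplying the previous congruence by [a^8 b^5] eliminates [r] and [w],
    which then enter only through [r b = a], [w a^3 = X b^3] and the derivative
    of the latter. *)
Lemma formal_ode n F H r w a b m :
  6 * ('X * F^`()) + F = H -> eqmodX n.+1 (H ^+ 2 * (1 - 'X)) 1 ->
  F.[0] != 0 -> a.[0] != 0 -> b.[0] != 0 -> m^`() = 0 ->
  eqmodX n.+1 (r * b) a -> eqmodX n.+1 (w * a ^+ 3) ('X * b ^+ 3) ->
  eqmodX n.+1 (F ^+ 2 * r) (m * (F \Po w) ^+ 2) ->
  eqmodX n (b * (a ^+ 3 - 'X * b ^+ 3))
    (m * (a * b + 3 * 'X * (a * b^`() - a^`() * b)) ^+ 2 * (1 - 'X)).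
Proof.
move=> eH hH F0 a0 b0 m' hr hw hF.
have w0 : w.[0] = 0.
  have := eqmodX_at0 hw; rewrite !(horner_exp, hornerM) hornerX mul0r => /eqP.
  by rewrite mulf_eq0 expf_eq0 (negbTE a0) orbF => /eqP.
have r0 : r.[0] != 0.
  by apply: contraNneq a0 => e; rewrite -(eqmodX_at0 hr) hornerM e mul0r.
have hwr : eqmodX n.+1 (w * r ^+ 3) 'X.
  apply: (@eqmodX_cancel _ _ (b ^+ 3)); first by rewrite horner_exp expf_neq0.
  rewrite (_ : b ^+ 3 * _ = w * (r * b) ^+ 3); last by ring.
  by rewrite [b ^+ 3 * 'X]mulrC; apply: eqmodX_trans (eqmodXMl _ (eqmodXX 3 hr)) hw.
have h := formal_differentiation eH hH F0 r0 w0 m' hwr hF.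
set E := _ + _ * (_ - _).
have hrn : eqmodX n (r * b) a by apply: eqmodXW hr.
have hwn : eqmodX n (w * a ^+ 3) ('X * b ^+ 3) by apply: eqmodXW hw.
have hw' : eqmodX n (w^`() * a ^+ 4) (b ^+ 2 * E).
  have := eqmodX_deriv hw; rewrite !(deriv_exp, derivM) derivX /= => /(eqmodXMl a) hd.
  have {hd} := eqmodXB hd (eqmodXMl (3 * a^`()) hwn).
  rewrite (_ : a * _ - _ = w^`() * a ^+ 4); last by ring.
  by rewrite (_ : a * _ - _ = b ^+ 2 * E) //; rewrite /E; ring.
apply: (@eqmodX_cancel _ _ (a ^+ 5 * b ^+ 4)).
  by rewrite hornerM !horner_exp mulf_neq0 ?expf_neq0.
have h1 := eqmodXMl (a ^+ 8 * b ^+ 5) h.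
have h2 : eqmodX n (a ^+ 8 * b ^+ 5 * (1 - w)) (a ^+ 5 * b ^+ 4 * (b * (a ^+ 3 - 'X * b ^+ 3))).
  rewrite (_ : _ * (1 - w) = a ^+ 8 * b ^+ 5 - a ^+ 5 * b ^+ 5 * (w * a ^+ 3)); last by ring.
  rewrite (_ : _ * (b * _) = a ^+ 8 * b ^+ 5 - a ^+ 5 * b ^+ 5 * ('X * b ^+ 3)); last by ring.
  by apply: eqmodXB (eqmodX_refl _ _) _; apply: eqmodXMl.
apply: eqmodX_trans (eqmodX_sym h2) (eqmodX_trans h1 _).
rewrite (_ : a ^+ 8 * _ * _ = m * (1 - 'X) * ((r * b) ^+ 5 * (w^`() * a ^+ 4) ^+ 2)); last by ring.
rewrite (_ : a ^+ 5 * _ * _ = m * (1 - 'X) * (a ^+ 5 * (b ^+ 2 * E) ^+ 2)); last by ring.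
by apply/eqmodXMl/eqmodXM/eqmodXX => //; apply: eqmodXX.
Qed.

End Formal.

Local Open Scope classical_set_scope.
Local Open Scope ring_scope.

(** * Orders of vanishing at the origin *)

Section BigO.
Variable K : numFieldType.
Implicit Types (f g u v : K -> K) (p : {poly K}) (n m : nat).

(** The origin is left out: the functions below involve [1 / z]. *)
Definition order_ge n f := exists2 C : K, 0 <= C &
  \forall z \near (0 : K)^', `|f z| <= C * `|z| ^+ n.

Lemma near0_ex (S : set K) : (\forall z \near (0 : K)^', S z) -> exists z, S z.
Proof. exact: filter_ex. Qed.

Lemma order_ge_congr n f g : (\forall z \near (0 : K)^', f z = g z) ->
  order_ge n f -> order_ge n g.
Proof.
move=> e [C C0 h]; exists C => //; near=> z.
have <- : f z = g z by near: z.
by near: z.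
Unshelve. all: by end_near. Qed.

Lemma order_geD n f g : order_ge n f -> order_ge n g -> order_ge n (fun z => f z + g z).
Proof.
move=> [C C0 hf] [D D0 hg]; exists (C + D); first exact: addr_ge0.
near=> z; rewrite (le_trans (ler_normD _ _)) // mulrDl lerD //; by near: z.
Unshelve. all: by end_near. Qed.

Lemma order_geM n m f g : order_ge n f -> order_ge m g ->
  order_ge (n + m) (fun z => f z * g z).
Proof.
move=> [C C0 hf] [D D0 hg]; exists (C * D); first exact: mulr_ge0.
near=> z; rewrite normrM exprD mulrACA ler_pM //; by near: z.
Unshelve. all: by end_near. Qed.

Lemma order_ge_cst (c : K) : order_ge 0 (fun=> c).
Proof. by exists `|c| => //; near=> z; rewrite expr0 mulr1. Unshelve. all: by end_near. Qed.

Lemma order_ge_id : order_ge 1 id.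
Proof. by exists 1 => //; near=> z; rewrite expr1 mul1r. Unshelve. all: by end_near. Qed.

Lemma order_geW m n f : (n <= m)%N -> order_ge m f -> order_ge n f.
Proof.
move=> le_nm [C C0 hf]; exists C => //; near=> z.
have z1 : `|z| <= 1 by apply/ltW; near: z; apply: dnbhs0_lt.
apply: (@le_trans _ _ (C * `|z| ^+ m)); first by near: z.
by rewrite ler_wpM2l // ler_wiXn2l.
Unshelve. all: by end_near. Qed.

Lemma order_geMl n f g : order_ge 0 g -> order_ge n f -> order_ge n (fun z => g z * f z).
Proof. by move=> hg hf; have := order_geM hg hf. Qed.

Lemma order_ge_le n f g (C : K) : 0 <= C ->
  (\forall z \near (0 : K)^', `|f z| <= C * `|g z|) -> order_ge n g -> order_ge n f.
Proof.
move=> C0 h [D D0 hg]; exists (C * D); first exact: mulr_ge0.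
near=> z; apply: (@le_trans _ _ (C * `|g z|)); first by near: z.
by rewrite -mulrA ler_wpM2l //; near: z.
Unshelve. all: by end_near. Qed.

Lemma order_geX n f : order_ge 1 f -> order_ge n (fun z => f z ^+ n).
Proof.
move=> h; elim: n => [|n IH].
  by apply: order_ge_congr (order_ge_cst 1); near=> z; rewrite expr0.
by apply: order_ge_congr (order_geM h IH); near=> z; rewrite exprS.
Unshelve. all: by end_near. Qed.

Lemma order_geN n f : order_ge n f -> order_ge n (fun z => - f z).
Proof. by move=> [C C0 h]; exists C => //; near=> z; rewrite normrN; near: z. Unshelve. all: by end_near. Qed.

Lemma order_ge_comp_poly p f : order_ge 0 f -> order_ge 0 (fun z => p.[f z]).
Proof.
move=> hf; elim/poly_ind: p => [|p c IH].
  by apply: order_ge_congr (order_ge_cst 0); near=> z; rewrite horner0.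
apply: order_ge_congr (order_geD (order_geM IH hf) (order_ge_cst c)).
by near=> z; rewrite hornerMXaddC.
Unshelve. all: by end_near. Qed.

Lemma order_ge_poly p : order_ge 0 (fun z => p.[z]).
Proof. exact/order_ge_comp_poly/(order_geW _ order_ge_id). Qed.

Lemma order_ge_dvd n p : 'X^n %| p -> order_ge n (fun z => p.[z]).
Proof.
case/dvdpP => q ->; have hX : order_ge n (fun z => z ^+ n).
  by exists 1 => //; near=> z; rewrite normrX mul1r.
apply: order_ge_congr (order_geMl (order_ge_poly q) hX).
by near=> z; rewrite hornerM hornerXn.
Unshelve. all: by end_near. Qed.

Lemma order_ge1_small f (e : K) : 0 < e -> order_ge 1 f ->
  \forall z \near (0 : K)^', `|f z| < e.
Proof.
move=> e0 [C C0 hf]; have C1 : 0 < C + 1 by rewrite ltr_wpDl.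
near=> z; apply: (@le_lt_trans _ _ (C * `|z| ^+ 1)); first by near: z.
rewrite expr1 (@le_lt_trans _ _ ((C + 1) * `|z|)) ?ler_wpM2r ?lerDl // mulrC -ltr_pdivlMr //.
by near: z; apply: dnbhs0_lt; rewrite divr_gt0.
Unshelve. all: by end_near. Qed.

Lemma order_ge_poly0 p : order_ge 1 (fun z => p.[z] - p.[0]).
Proof.
have : order_ge 1 (fun z => (p - p.[0]%:P).[z]).
  apply: order_ge_dvd; rewrite expr1 -['X]subr0 -[X in 'X - X]/(0%:P).
  by rewrite dvdp_XsubCl /root hornerD hornerN hornerC subrr.
by apply: order_ge_congr; near=> z; rewrite hornerD hornerN hornerC.
Unshelve. all: by end_near. Qed.

Lemma poly_lower_bound p : p.[0] != 0 ->
  \forall z \near (0 : K)^', `|p.[0]| / 2 <= `|p.[z]|.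
Proof.
move=> p0; have h0 : 0 < `|p.[0]| / 2 by rewrite divr_gt0 ?normr_gt0.
near=> z.
have h : `|p.[z] - p.[0]| < `|p.[0]| / 2.
  by near: z; apply: order_ge1_small h0 (order_ge_poly0 p).
have : `|p.[0]| <= `|p.[z]| + `|p.[z] - p.[0]|.
  by rewrite -[X in `|X| <= _](subrKC p.[z]) (le_trans (ler_normD _ _)) // lerD2l distrC.
move=> h1; have := le_trans h1 (lerD (lexx _) (ltW h)).
by rewrite -lerBlDr {1}[`|p.[0]|]splitr addrK.
Unshelve. all: by end_near. Qed.

Lemma near_poly_neq0 p : p.[0] != 0 -> \forall z \near (0 : K)^', p.[z] != 0.
Proof.
move=> p0; near=> z; rewrite -normr_gt0 (@lt_le_trans _ _ (`|p.[0]| / 2)) //.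
  by rewrite divr_gt0 ?normr_gt0.
by near: z; apply: poly_lower_bound.
Unshelve. all: by end_near. Qed.

Lemma order_ge_inv_poly p : p.[0] != 0 -> order_ge 0 (fun z => p.[z]^-1).
Proof.
move=> p0; have h0 : 0 < `|p.[0]| / 2 by rewrite divr_gt0 ?normr_gt0.
exists (`|p.[0]| / 2)^-1; first by rewrite invr_ge0 ltW.
near=> z; rewrite expr0 mulr1 normfV lef_pV2 ?posrE ?normr_gt0 //.
  by near: z; apply: poly_lower_bound.
by near: z; apply: near_poly_neq0.
Unshelve. all: by end_near. Qed.

Lemma order_ge_comp_sub p n u v : order_ge 0 u -> order_ge 0 v ->
  order_ge n (fun z => u z - v z) -> order_ge n (fun z => p.[u z] - p.[v z]).
Proof.
move=> hu hv huv; elim/poly_ind: p => [|p c IH].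
  apply: order_ge_congr (order_geMl (order_ge_cst 0) huv).
  by near=> z; rewrite !horner0 subrr mul0r.
apply: order_ge_congr (order_geD (order_geMl hu IH)
   (order_geMl (order_ge_comp_poly p hv) huv)).
by near=> z; rewrite !hornerMXaddC; ring.
Unshelve. all: by end_near. Qed.

(** Analytic and algebraic orders of vanishing agree for polynomials; this is
    how estimates become congruences between truncated power series. *)
Lemma order_ge_polyP n p : order_ge n (fun z => p.[z]) -> 'X^n %| p.
Proof.
elim: n p => [|n IH] p h; first by rewrite expr0 dvd1p.
have p0 : p.[0] = 0.
  apply/eqP; apply: contraT => nz.
  have h1 : order_ge 1 (fun z => p.[z]) by apply: order_geW h.
  have h0 : 0 < `|p.[0]| / 2 by rewrite divr_gt0 ?normr_gt0.
  have [z []] : exists z, `|p.[0]| / 2 <= `|p.[z]| /\ `|p.[z]| < `|p.[0]| / 2.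
    apply: near0_ex; near=> z; split; near: z; first exact: poly_lower_bound.
    exact: order_ge1_small.
  by move=> h2 h3; have := le_lt_trans h2 h3; rewrite ltxx.
have /factor_theorem[q eq] : root p 0 by apply/eqP.
rewrite subr0 in eq; rewrite eq exprSr dvdp_mul2r ?polyX_eq0 //; apply: IH.
case: h => C C0 h; exists C => //; near=> z.
have z0 : 0 < `|z| by rewrite normr_gt0; near: z; apply: nbhs_dnbhs_neq.
rewrite -(ler_pM2r z0) -mulrA -exprSr -normrM.
rewrite (_ : q.[z] * z = p.[z]); last by rewrite eq hornerMX.
by near: z.
Unshelve. all: by end_near. Qed.

End BigO.

Local Open Scope complex_scope.

(** * The hypergeometric function near the origin *)

Section ComplexSeries.
Variable R : realType.
Implicit Types (u : nat -> R[i]) (z l : R[i]).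

Lemma complex_norm_le z : `|z| <= (`|complex.Re z| + `|complex.Im z|)%:C.
Proof.
have e (x : R) : `|x%:C| = `|x|%:C.
  by rewrite normc_def /= expr0n addr0 sqrtr_sqr.
have i1 : `|'i%C| = 1 :> R[i] by rewrite normc_def /= expr0n add0r expr1n sqrtr1.
rewrite {1}[z]complexE (le_trans (ler_normD _ _)) // normrM i1 mul1r !e.
by rewrite -rmorphD.
Qed.

Lemma ReD (x y : R[i]) : complex.Re (x + y) = complex.Re x + complex.Re y.
Proof. by case: x y => [? ?] []. Qed.
Lemma ImD (x y : R[i]) : complex.Im (x + y) = complex.Im x + complex.Im y.
Proof. by case: x y => [? ?] []. Qed.

Lemma Re_series u n : complex.Re (series u n) = series (fun k => complex.Re (u k)) n.
Proof. by rewrite /series /= (big_morph _ ReD (erefl _)). Qed.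
Lemma Im_series u n : complex.Im (series u n) = series (fun k => complex.Im (u k)) n.
Proof. by rewrite /series /= (big_morph _ ImD (erefl _)). Qed.

Lemma real_dominated_series (v g : nat -> R) :
  (forall k, `|v k| <= g k) -> cvgn (series g) -> cvgn (series v).
Proof.
move=> h hg; apply: normed_cvg; apply: series_le_cvg hg => k /=.
- exact: normr_ge0.
- exact: le_trans (normr_ge0 _) (h k).
- exact: h.
Qed.

Lemma normc_ge_Im z : `|complex.Im z|%:C <= `|z|.
Proof.
have := normc_ge_Re (z * 'i%C); rewrite ReiNIm normrN.
by rewrite normrM [`|'i%C|]normc_def /= expr0n add0r expr1n sqrtr1 mulr1.
Qed.

(** Completeness of the reals is applied to real and imaginary parts. *)
Lemma complex_dominated_series u (g : nat -> R) :
  (forall k, `|u k| <= (g k)%:C) -> cvgn (series g) ->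
  exists l : R[i], (series u : nat -> (R[i] : numFieldType)) @ \oo --> (l : (R[i] : numFieldType)).
Proof.
move=> h hg.
have hr : cvgn (series (fun k => complex.Re (u k))).
  by apply: real_dominated_series hg => k; rewrite -lecR (le_trans (normc_ge_Re _)).
have hi : cvgn (series (fun k => complex.Im (u k))).
  by apply: real_dominated_series hg => k; rewrite -lecR (le_trans (normc_ge_Im _)).
have [lr {}hr] : exists lr : R, series (fun k => complex.Re (u k)) @ \oo --> lr.
  by exists (limn (series (fun k => complex.Re (u k)))).
have [li {}hi] : exists li : R, series (fun k => complex.Im (u k)) @ \oo --> li.
  by exists (limn (series (fun k => complex.Im (u k)))).
exists (lr +i* li); apply/cvgrPdist_lt => e e0.
have e0' : 0 < complex.Re e by move: e0; rewrite ltcE => /andP[].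
have ee : e = (complex.Re e)%:C by rewrite RRe_real // gtr0_real.
have e2 : 0 < complex.Re e / 2 by rewrite divr_gt0.
near=> n.
rewrite (le_lt_trans (complex_norm_le _)) // ee ltcR [X in _ < X]splitr.
have hR : `|lr - series (fun k => complex.Re (u k)) n| < complex.Re e / 2.
  by near: n; move/cvgrPdist_lt: hr; apply.
have hI : `|li - series (fun k => complex.Im (u k)) n| < complex.Re e / 2.
  by near: n; move/cvgrPdist_lt: hi; apply.
apply: le_lt_trans (ltrD hR hI).
rewrite -Re_series -Im_series; case: (series u n) => x y /=; by [].
Unshelve. all: by end_near. Qed.

(** The sum telescopes, since [x^k <= 2 x^k - 2 x^(k+1)]. *)
Lemma geometric_tail (x : R[i]) m n : 0 <= x -> 2 * x <= 1 -> (m <= n)%N ->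
  \sum_(m <= k < n) x ^+ k <= 2 * x ^+ m - 2 * x ^+ n.
Proof.
move=> x0 x1; elim: n => [|n IH]; first by rewrite leqn0 => /eqP ->; rewrite big_geq // subrr.
rewrite leq_eqVlt => /orP[/eqP <-|]; first by rewrite big_geq // subrr.
rewrite ltnS => le_mn; rewrite big_nat_recr //= (le_trans (lerD (IH le_mn) (lexx _))) //.
rewrite -addrA lerD2l -subr_ge0 exprS.
rewrite (_ : _ - _ = x ^+ n * (1 - 2 * x)); last by ring.
by rewrite mulr_ge0 ?exprn_ge0 ?subr_ge0.
Qed.

Lemma power_series_tail (c : nat -> R[i]) z m :
  (forall k, `|c k| <= 1) -> 2 * `|z| <= 1 ->
  `|limn (series (fun k => c k * z ^+ k) : nat -> (R[i] : numFieldType)) -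
    \sum_(0 <= k < m) c k * z ^+ k| <= 2 * `|z| ^+ m.
Proof.
move=> c1 z1; pose u k := c k * z ^+ k.
have hu k : `|u k| <= `|z| ^+ k.
  by rewrite normrM normrX ler_piMl ?exprn_ge0.
have [l hl] : exists l : R[i],
      (series u : nat -> (R[i] : numFieldType)) @ \oo --> (l : (R[i] : numFieldType)).
  pose x := complex.Re `|z|; have ex : `|z| = x%:C by rewrite RRe_real // normr_real.
  apply: (@complex_dominated_series _ (geometric 1 x)) => [k|].
    by rewrite /= mul1r (le_trans (hu k)) // ex rmorphXn.
  have x2 : 2 * x <= 1 by move: z1; rewrite ex -lecR rmorphM /= rmorph_nat.
  have x0 : 0 <= x by rewrite -ler0c -ex.
  apply: is_cvg_geometric_series; rewrite ger0_norm //.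
  apply: (@le_lt_trans _ _ (1 / 2)); first by rewrite ler_pdivlMr // mulrC.
  by rewrite ltr_pdivrMr // mul1r ltr1n.
rewrite (cvg_lim (@norm_hausdorff _ _) hl).
set S := \sum_(_ <= _ < _) _; set B := 2 * _.
have B0 : 0 <= B by rewrite mulr_ge0 ?exprn_ge0.
rewrite real_leNgt ?ger0_real //; apply/negP => lt_B.
have d0 : 0 < `|l - S| - B by rewrite subr_gt0.
have [n [h1 h2]] : exists n, `|l - series u n| < `|l - S| - B /\ (m <= n)%N.
  apply: (@filter_ex _ \oo); near=> n; split; near: n; last exact: nbhs_infty_ge.
  by move/cvgrPdist_lt: hl; apply.
have h3 : `|series u n - S| <= B.
  rewrite /series /= /S (big_cat_nat (leq0n m) h2) /= [X in X - _]addrC addrK.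
  rewrite (le_trans (ler_norm_sum _ _ _)) //.
  rewrite (le_trans (ler_sum _ (fun k _ => hu k))) //.
  rewrite (le_trans (geometric_tail _ _ h2)) // gerBl mulr_ge0 ?exprn_ge0 //.
have := ler_normD (l - series u n) (series u n - S); rewrite addrA subrK => h4.
have := le_lt_trans h4 (ltr_leD h1 h3); by rewrite subrK ltxx.
Unshelve. all: by end_near. Qed.

Lemma hyp2F1_tail n z : 2 * `|z| <= 1 ->
  `|hyp2F1 (1 / 2) (1 / 6) (7 / 6) z - (hyp_trunc R[i] n).[z]| <= 2 * `|z| ^+ n.+1.
Proof.
move=> z1; rewrite /hyp2F1 /hyp_trunc horner_poly.
rewrite -(big_mkord xpredT (fun k => hyp2F1_coef (1 / 2) (1 / 6) (7 / 6) k * z ^+ k)).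
apply: power_series_tail z1 => k; rewrite hyp2F1_coefE.
have /andP[h0 h1] := binom_coef_bounds R[i] k.
rewrite normrM ger0_norm // normfV ger0_norm ?ler0n //.
rewrite mulr_ile1 ?invr_ge0 ?ler0n // invf_le1 ?ler1n ?ltr0n ?addn1 //.
Qed.

End ComplexSeries.

(** * From the point at infinity to the origin *)

Section Reversal.
Variable K : numClosedFieldType.
Implicit Types (p N D : {poly K}) (z : K) (k : nat).

Definition rev_poly k p : {poly K} := \poly_(i < k.+1) p`_(k - i).

Lemma horner_rev_poly k p z : (size p <= k.+1)%N -> z != 0 ->
  (rev_poly k p).[z] = z ^+ k * p.[z^-1].
Proof.
move=> sp z0; rewrite horner_poly (horner_coef_wide _ sp) mulr_sumr.
rewrite (reindex_inj rev_ord_inj) /=; apply: eq_bigr => i _.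
have ik : (i <= k)%N by rewrite -ltnS ltn_ord.
rewrite subSS subKn // mulrCA; congr (_ * _).
by rewrite -[in z ^+ k](subnK ik) exprD -mulrA exprVn divff ?expf_neq0 // mulr1.
Qed.

Lemma rev_poly0 k p : (rev_poly k p).[0] = p`_k.
Proof. by rewrite horner_coef0 coef_poly subn0. Qed.

Lemma deriv_rev_poly k p :
  'X * (rev_poly k p)^`() = k%:R *: rev_poly k p - rev_poly k ('X * p^`()).
Proof.
apply/polyP => i; rewrite coefXM coefB coefZ coef_deriv !coef_poly.
have -> : ('X * p^`())`_(k - i) = (k - i)%:R * p`_(k - i).
  by rewrite coefXM coef_deriv mulr_natl; case: (k - i)%N => [|j]; rewrite //= mulr0n.
case: i => [|i] /=; first by rewrite subn0 subrr.
case: ltnP => [ik|_]; last by rewrite mul0rn mulr0 subr0.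
by rewrite natrB // -mulr_natl; ring.
Qed.

(** Evaluation at [z = 1 / s], where [rev_poly k p] is [z^k p(s)] and its
    derivative is given by [deriv_rev_poly]. *)
Lemma rev_ode N D k (m : K) (a := rev_poly k N) (b := rev_poly k D) :
  (size N <= k.+1)%N -> (size D <= k.+1)%N ->
  b * (a ^+ 3 - 'X * b ^+ 3) =
    m%:P * (a * b + 3 * 'X * (a * b^`() - a^`() * b)) ^+ 2 * (1 - 'X) ->
  m *: ((N * D + 3 *: 'X * (N^`() * D - N * D^`())) ^+ 2 * ('X - 1)) =
    D * ('X * N ^+ 3 - D ^+ 3).
Proof.
move=> sN sD e; apply: subr0_eq; apply: (@poly0_cofinite _ _ [:: 0]) => s.
rewrite inE => s0; have z0 : s^-1 != 0 by rewrite invr_eq0.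
have sX (p : {poly K}) : (size p <= k.+1)%N -> (size ('X * p^`())%R <= k.+1)%N.
  move=> h; rewrite mulrC; case: (eqVneq p^`() 0) => [->|p0]; first by rewrite mul0r size_poly0.
  by rewrite size_mulX // (leq_trans (lt_size_deriv _)) //; apply: contraNneq p0 => ->; rewrite linear0.
have E : a * b + 3 * 'X * (a * b^`() - a^`() * b) =
    a * b + 3%:P * (a * ('X * b^`()) - ('X * a^`()) * b).
  by rewrite -[3%:P]/((3%:R)%:P) polyC_natr; ring.
have := congr1 (horner^~ s^-1) e; rewrite E !deriv_rev_poly; push_eval.
rewrite !horner_rev_poly ?sX // !invrK; push_eval => {}e.
apply/eqP; rewrite subr_eq0; apply/eqP.
have zk : s^-1 ^+ k != 0 by rewrite expf_neq0.
apply: (mulfI (expf_neq0 4 zk)); apply: (mulfI z0).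
move: zk e; move: (s^-1 ^+ k) => t t0 e.
transitivity (t * D.[s] * ((t * N.[s]) ^+ 3 - s^-1 * (t * D.[s]) ^+ 3)); last by field.
by rewrite e; field.
Qed.

Lemma near_poly_nonzero p : p != 0 -> \forall z \near (0 : K)^', p.[z] != 0.
Proof.
move=> p0; have [n [q]] := multiplicity_XsubC p 0; rewrite p0 subr0 /= => q0 ->.
near=> z; rewrite hornerM hornerXn mulf_neq0 ?expf_neq0 //; near: z.
  exact: near_poly_neq0.
exact: nbhs_dnbhs_neq.
Unshelve. all: by end_near. Qed.

Lemma near_rev_poly N D k : (size N <= k.+1)%N -> (size D <= k.+1)%N ->
  \forall z \near (0 : K)^',
    N.[z^-1] / D.[z^-1] = (rev_poly k N).[z] / (rev_poly k D).[z].
Proof.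
move=> sN sD; near=> z; have z0 : z != 0 by near: z; apply: nbhs_dnbhs_neq.
by rewrite !horner_rev_poly // invfM mulrACA divff ?mul1r // expf_neq0.
Unshelve. all: by end_near. Qed.

(** At [z = 1 / s] the limit says that [a - l b] is less than any multiple of [b]
    near the origin, so [a(0) = l b(0)]. By the choice of [k], one of these two
    values is a leading coefficient, and not zero. *)
Lemma limit_at_infinity N D (l : K) (k := (maxn (size N) (size D)).-1) :
  D != 0 -> l != 0 -> cvg_at_infinity (fun s => N.[s] / D.[s]) l ->
  [/\ size N = size D, (rev_poly k N).[0] = l * (rev_poly k D).[0] &
      (rev_poly k D).[0] != 0].
Proof.
move=> D0 l0 hl; set a := rev_poly k N; set b := rev_poly k D.
have sD0 : (0 < size D)%N by rewrite lt0n size_poly_eq0.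
have sk : k.+1 = maxn (size N) (size D) by rewrite prednK // leq_max sD0 orbT.
have sN : (size N <= k.+1)%N by rewrite sk leq_maxl.
have sD : (size D <= k.+1)%N by rewrite sk leq_maxr.
have b0 : b != 0.
  have [s [sn Ds]] : exists s, s != 0 /\ D.[s] != 0.
    apply: near0_ex; near=> s; split; near: s; first exact: nbhs_dnbhs_neq.
    exact: near_poly_nonzero.
  apply: contraNneq Ds => b0; have := horner_rev_poly sD (invr_neq0 sn).
  rewrite -/b b0 horner0 invrK => /esym/eqP; rewrite mulf_eq0 expf_eq0 invr_eq0.
  by rewrite (negbTE sn) andbF.
have ab : a.[0] = l * b.[0].
  apply/eqP; rewrite -subr_eq0; apply: contraT => nz.
  pose p := a - l *: b.
  have ep z : p.[z] = a.[z] - l * b.[z] by rewrite /p; push_eval.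
  have p0 : p.[0] != 0 by rewrite ep.
  have h0 : 0 < `|p.[0]| / 2 by rewrite divr_gt0 ?normr_gt0.
  have [C C0 hb] := order_ge_poly b; have C1 : 0 < C + 1 by rewrite ltr_wpDl.
  have e0 : 0 < `|p.[0]| / 2 / (C + 1) by rewrite divr_gt0.
  have [M M0 hM] := hl _ e0.
  have [z [z0 bz lz pz bC]] : exists z, [/\ z != 0, b.[z] != 0, `|z| < M^-1,
      `|p.[0]| / 2 <= `|p.[z]| & `|b.[z]| <= C * `|z| ^+ 0].
    apply: near0_ex; near=> z; split; near: z => //.
    - exact: nbhs_dnbhs_neq.
    - exact: near_poly_nonzero.
    - by apply: dnbhs0_lt; rewrite invr_gt0.
    - exact: poly_lower_bound.
  have zM : M < `|z^-1|.
    by rewrite normfV -[M]invrK ltf_pV2 ?posrE ?invr_gt0 ?normr_gt0.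
  have := hM _ zM.
  have -> : N.[z^-1] / D.[z^-1] - l = p.[z] / b.[z].
    have zk : z ^+ k != 0 by rewrite expf_neq0.
    have := bz; rewrite ep /a /b !horner_rev_poly // mulf_eq0 negb_or => /andP[_ d].
    by field; rewrite zk d.
  rewrite normrM normfV ltr_pdivrMr ?normr_gt0 // => h1.
  have := le_lt_trans pz h1; move: (`|p.[0]| / 2) h0 => t t0.
  rewrite -mulrA ltr_pMr // mulrC ltr_pdivlMr // mul1r => h2.
  rewrite expr0 mulr1 in bC; have := lt_le_trans h2 bC.
  by rewrite gtrDl ltr10.
have bn : b.[0] != 0.
  apply: contraT; rewrite negbK => /eqP b00.
  have a00 : a.[0] = 0 by rewrite ab b00 mulr0.
  rewrite /a /b !rev_poly0 in a00 b00.
  have [le|lt] := leqP (size N) (size D).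
    have ek : k = (size D).-1 by rewrite /k (maxn_idPr le).
    by move: D0; rewrite -lead_coef_eq0 /lead_coef -ek b00 eqxx.
  have ek : k = (size N).-1 by rewrite /k (maxn_idPl (ltnW lt)).
  have : N != 0 by rewrite -size_poly_gt0 (leq_ltn_trans _ lt).
  by rewrite -lead_coef_eq0 /lead_coef -ek a00 eqxx.
have an : a.[0] != 0 by rewrite ab mulf_neq0.
split=> //.
rewrite /a /b !rev_poly0 in bn an.
have gt p : p`_k != 0 -> (k < size p)%N.
  by move=> h; rewrite ltnNge; apply: contra h => h; rewrite nth_default.
have kN := gt _ an; have kD := gt _ bn.
by apply/eqP; rewrite eqn_leq (leq_trans sN kD) (leq_trans sD kN).
Unshelve. all: by end_near. Qed.

End Reversal.

(** * From the identity of functions to the isogeny *)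

Lemma squared_identity (K : fieldType) (x y a b m : K) :
  a != 0 -> b != 0 -> m != 0 -> x ^+ 2 = (a / b / m)^-1 * y ^+ 2 ->
  x ^+ 2 * (a / b) = m * y ^+ 2.
Proof. by move=> a0 b0 m0 ->; field; rewrite a0 b0 m0. Qed.

(** Here [x], [y], [r] will be analytic functions, and [x'], [y'], [r'] their
    truncations: each summand on the left contains one truncation error. *)
Lemma telescoping_identity (K : comPzRingType) (x y x' y' r r' m : K) :
  x ^+ 2 * r = m * y ^+ 2 ->
  - ((x + x') * r') * (x - x') + - (x * x) * (r - r') + m * (y + y') * (y - y') =
  x' ^+ 2 * r' - m * y' ^+ 2.
Proof.
move=> e; transitivity (m * y ^+ 2 - x ^+ 2 * r + (x' ^+ 2 * r' - m * y' ^+ 2)).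
  by ring.
by rewrite e subrr add0r.
Qed.

(** Squaring removes the branch of the square root. Then the functions [hyp2F1],
    [rho] and [z / rho^3] are replaced by polynomials that agree with them up to
    [O(z^(n+1))]; what remains is a polynomial of that order, so it is divisible
    by [X^(n+1)]. *)
Lemma hyp2F1_truncated_identity (R : realType) (mu0 : R[i]) (a b r w : {poly R[i]})
    (rho : R[i] -> R[i]) (n : nat) :
  mu0 != 0 -> a.[0] != 0 -> b.[0] != 0 ->
  (\forall z \near (0 : (R[i] : numFieldType))^', rho z = a.[z] / b.[z]) ->
  (\forall z \near (0 : (R[i] : numFieldType))^',
     hyp2F1 (1 / 2) (1 / 6) (7 / 6) z =
     pow_mhalf (rho z / mu0) * hyp2F1 (1 / 2) (1 / 6) (7 / 6) (z / rho z ^+ 3)) ->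
  eqmodX n.+1 (r * b) a -> eqmodX n.+1 (w * a ^+ 3) ('X * b ^+ 3) ->
  eqmodX n.+1 (hyp_trunc R[i] n ^+ 2 * r) (mu0%:P * (hyp_trunc R[i] n \Po w) ^+ 2).
Proof.
move=> m0 a0 b0 hrho hid hr hw; set F := hyp_trunc R[i] n.
pose K : numFieldType := R[i].
pose f : K -> K := hyp2F1 (1 / 2) (1 / 6) (7 / 6).
pose W : K -> K := fun z => z * (b.[z] ^+ 3 * a.[z]^-1 ^+ 3).
have oa : order_ge 0 (fun z : K => a.[z]^-1) by apply: order_ge_inv_poly.
have ob : order_ge 0 (fun z : K => b.[z]^-1) by apply: order_ge_inv_poly.
have oX3 (g : K -> K) : order_ge 0 g -> order_ge 0 (fun z => g z ^+ 3).
  move=> og; apply: order_ge_congr (order_geM og (order_geM og og)).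
  by near=> z; ring.
have oW : order_ge 1 W.
  by have := order_geM (order_ge_id K) (order_geM (oX3 _ (order_ge_poly b)) (oX3 _ oa)).
have oW0 : order_ge 0 W by apply: order_geW oW.
have of_ : order_ge n.+1 (fun z => f z - F.[z]).
  exists 2 => //; near=> z; apply: hyp2F1_tail.
  rewrite mulrC -ler_pdivlMr //; apply: ltW; near: z; apply: dnbhs0_lt; exact: divr_gt0.
have ofW : order_ge n.+1 (fun z => f (W z) - F.[W z]).
  apply: (order_ge_le _ _ (order_geX n.+1 oW) (C := 2)) => //; near=> z; rewrite normrX.
  apply: hyp2F1_tail; rewrite mulrC -ler_pdivlMr //; apply: ltW; near: z.
  by apply: order_ge1_small oW; apply: divr_gt0.
have odiv : order_ge n.+1 (fun z : K => a.[z] / b.[z] - r.[z]).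
  apply: order_ge_congr (order_geMl (order_geN ob) (order_ge_dvd hr)).
  near=> z; rewrite hornerD hornerN hornerM; field; near: z; exact: near_poly_neq0.
have oWw : order_ge n.+1 (fun z => W z - w.[z]).
  apply: order_ge_congr (order_geMl (order_geN (oX3 _ oa)) (order_ge_dvd hw)).
  near=> z; rewrite hornerD hornerN !(horner_exp, hornerM) hornerX /W; field.
  near: z; exact: near_poly_neq0.
have oF := order_ge_poly F; have ow := order_ge_poly w.
have ofb : order_ge 0 f.
  apply: order_ge_congr (order_geD (order_geW (leq0n _) of_) oF).
  by near=> z; rewrite subrK.
have oFw := order_ge_comp_poly F ow.
have ofWw : order_ge n.+1 (fun z => f (W z) - F.[w.[z]]).
  apply: order_ge_congr (order_geD ofW (order_ge_comp_sub F oW0 ow oWw)).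
  by near=> z; rewrite addrA subrK.
have ofWb : order_ge 0 (fun z => f (W z)).
  apply: order_ge_congr (order_geD (order_geW (leq0n _) ofWw) oFw).
  by near=> z; rewrite subrK.
rewrite /eqmodX; apply: order_ge_polyP.
have t1 := order_geMl (order_geN (order_geM (order_geD ofb oF) (order_ge_poly r))) of_.
have t2 := order_geMl (order_geN (order_geM ofb ofb)) odiv.
have t3 := order_geMl (order_geM (order_ge_cst mu0) (order_geD ofWb oFw)) ofWw.
apply: order_ge_congr (order_geD (order_geD t1 t2) t3).
near=> z.
have az : a.[z] != 0 by near: z; apply: near_poly_neq0.
have bz : b.[z] != 0 by near: z; apply: near_poly_neq0.
have e1 : rho z = a.[z] / b.[z] by near: z.
have eW : z / rho z ^+ 3 = W z by rewrite e1 /W; field; rewrite az bz.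
have : f z = pow_mhalf (rho z / mu0) * f (z / rho z ^+ 3) by near: z.
rewrite eW => /(congr1 (fun x => x ^+ 2)); rewrite exprMn pow_mhalf_sqr e1 => e2.
rewrite hornerD hornerN !(horner_exp, hornerM) hornerC horner_comp.
have e3 : f z ^+ 2 * (a.[z] / b.[z]) = mu0 * f (W z) ^+ 2.
  by apply: squared_identity e2.
by apply: telescoping_identity e3.
Unshelve. all: by end_near. Qed.

Unset Implicit Arguments.

Theorem theorem3p2 (R : realType) (mu : {fraction {poly R[i]}}) (mu0 : R[i])
    (mu0_neq0 : mu0 != 0)
    (mu_lim : cvg_at_infinity (rf_eval mu) mu0)
    (identity : \forall z \near (0 : (R[i] : numFieldType))^',
       hyp2F1 (1 / 2) (1 / 6) (7 / 6) z =
       pow_mhalf (rf_eval mu z^-1 / mu0) *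
       hyp2F1 (1 / 2) (1 / 6) (7 / 6) (z / rf_eval mu z^-1 ^+ 3)) :
  exists phi : E2 R[i] -> E2 R[i],
    [/\ E2_isogeny phi,
        exists P, phi P <> E2_zero R[i]
      & E2_transforms_x mu phi].
Proof.
set N := rf_num mu; set D := rf_den mu.
have D0 : D != 0 := rf_den_neq0 mu.
have copND : coprimep N D := coprime_rf mu.
pose k := (maxn (size N) (size D)).-1.
have [sND ab b0] := limit_at_infinity D0 mu0_neq0 mu_lim.
have a0 : (rev_poly k N).[0] != 0 by rewrite ab mulf_neq0.
have sD : (size D <= k.+1)%N by rewrite /k sND maxnn leqSpred.
have sN : (size N <= k.+1)%N by rewrite sND.
pose a := rev_poly k N; pose b := rev_poly k D.
have hrho := near_rev_poly sN sD.
pose B := N * D + 3 *: 'X * (N^`() * D - N * D^`()).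
have ode0 : mu0 *: (B ^+ 2 * ('X - 1)) = D * ('X * N ^+ 3 - D ^+ 3).
  apply: (rev_ode sN sD); apply: eqmodX_eq => n.
  have [b' hb] := eqmodX_inv n.+1 b0; have [a' ha] := eqmodX_inv n.+1 a0.
  have hr : eqmodX n.+1 (a * b' * b) a.
    by rewrite -mulrA [b' * b]mulrC -[X in eqmodX _ _ X]mulr1; apply: eqmodXMl.
  have hw : eqmodX n.+1 ('X * b ^+ 3 * a' ^+ 3 * a ^+ 3) ('X * b ^+ 3).
    rewrite -mulrA [a' ^+ 3 * _]mulrC -exprMn -[X in eqmodX _ _ X]mulr1.
    by apply: eqmodXMl; rewrite -[1](expr1n _ 3); apply: eqmodXX.
  have hF := hyp2F1_truncated_identity mu0_neq0 a0 b0 hrho identity hr hw.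
  apply: (formal_ode _ (binom_trunc_sqr _ n) _ a0 b0 _ hr hw hF).
  - exact: hyp_trunc_ode.
  - rewrite horner_coef0 coef_poly /= hyp2F1_coefE muln0 divr1.
    by rewrite /binom_coef /rising big_ord0 fact0 divr1 oner_neq0.
  - by rewrite derivC.
pose c := sqrtC mu0; have c2 : c ^+ 2 = mu0 by rewrite sqrtCK.
have c0 : c != 0 by rewrite sqrtC_eq0.
have ode : c ^+ 2 *: (B ^+ 2 * ('X - 1)) = D * ('X * N ^+ 3 - D ^+ 3) by rewrite c2.
exists (phi N D B c); split.
- split; first exact: phi_algebraic.
  by move=> P Q; apply: phiD.
- have [s hs] := @phi_generic _ N D B c D0 ode.
  by have [P /hs/eqP] := E2_infinite s; exists P.
move=> P x y eP; have [P0 ex _] := xyc_some eP; rewrite -ex.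
case: ifP => [/eqP d|/negbT d]; first exact: phi_pole.
by exists (phi_y D B c (xc P) (yc P)); rewrite phi_val // /phi_x -mulrA.
Qed.
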